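(* The inverse 2-maxian problem on a star graph with $n$ vertices under the $l_1$-norm cost function $\sum_{e\in E} c_e x_e$ can be solved in linear time, i.e. in $O(n)$ time: there is an algorithm that, for every instance, computes an optimal solution or reports that the problem is infeasible.
   Context: Let $T=(V,E)$ be a tree with $|V|=n$, vertex weights $w_i\ge 0$ ($v_i \in V$) and edge lengths $\ell_e\ge 0$ ($e\in E$). A point of $T$ is a vertex or a point in the interior of an edge; $d$ is the shortest-path distance and $P(u,v)$ the path joining $u$ and $v$. A set $X=\{x_1,x_2\}$ of two points of $T$ is a 2-maxian of $T$ if it maximizes $F(X)=\sum_{i=1}^n w_i\max\{d(v_i,x_1),d(v_i,x_2)\}$ over all sets of two points of $T$. Inverse 2-maxian problem: given two prespecified leaves $a,b$ of $T$, modification bounds $\bar x_e\ge 0$ and unit modification costs $c_e\ge 0$ for $e\in E$, choose modifications $x_e$ with $0\le x_e\le \bar x_e$ and set new lengths $\tilde\ell_e=\ell_e+x_e$ for $e\in P(a,b)$ and $\tilde\ell_e=\ell_e-x_e$ for $e\notin P(a,b)$. The new lengths must be non-negative, and $\{a,b\}$ must be a 2-maxian of $T$ with respect to the lengths $\tilde\ell$. The goal is to minimize the given cost function of $x$. A star graph is a tree consisting of a center vertex $v_0$ joined by an edge to every other vertex (the other vertices being the leaves). Running time is counted in elementary operations (arithmetic operations and comparisons) on the input numbers. *)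

(* Defs.v *)
From HB Require Import structures.
From mathcomp Require Import all_boot all_order all_algebra.
Set Implicit Arguments.
Unset Strict Implicit.
Unset Printing Implicit Defensive.
Import Order.TTheory GRing.Theory Num.Theory.
Local Open Scope ring_scope.

(** * Trees *)

Record tree (n : nat) := Tree {
  adj : rel 'I_n;
  adj_sym : symmetric adj;
  adj_irr : irreflexive adj;
  adj_connected : forall u v, connect adj u v;
  (* A two-element [ucycle] traverses one edge back and forth. *)
  adj_acyclic : forall c, ucycle adj c -> (size c < 3)%N }.

Definition edges n (T : tree n) : {set {set 'I_n}} :=
  [set e | [exists u, exists v, adj T u v && (e == [set u; v])]].

Definition is_leaf n (T : tree n) (v : 'I_n) : bool :=
  #|[set u | adj T v u]| == 1%N.

Definition simple_path n (T : tree n) (u v : 'I_n) (p : seq 'I_n) : bool :=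
  [&& path (adj T) u p, last u p == v & uniq (u :: p)].

Definition path_edges n (u : 'I_n) (p : seq 'I_n) : seq {set 'I_n} :=
  pairmap (fun x y => [set x; y]) u p.

(* The edges of P(u,v). The default is never used: a tree has exactly one
   simple path from u to v, and it has at most n vertices. *)
Definition tree_path n (T : tree n) (u v : 'I_n) : seq {set 'I_n} :=
  path_edges u
    (odflt [bseq] [pick p : n.-bseq 'I_n | simple_path T u v p]).

(** * Distances and 2-maxians

    Functions on edges have type [{set 'I_n} -> R]; only their values on
    [edges T] are ever relevant. *)

Section Maxian.
Variables (R : realFieldType) (n : nat) (T : tree n).
Implicit Types (len : {set 'I_n} -> R) (w : 'I_n -> R).

Definition path_length len (u : 'I_n) (p : seq 'I_n) : R :=
  \sum_(e <- path_edges u p) len e.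

(* Lengths are nonnegative, so simple paths suffice for shortest paths. As in
   [tree_path], the default is never used. *)
Definition vdist len (u v : 'I_n) : R :=
  path_length len u
    [arg min_(p < [bseq] : n.-bseq 'I_n | simple_path T u v p)
       path_length len u p]%O.

(* [Inner u v t] lies on the edge uv at distance t from u; taking u < v gives
   each interior point exactly one representation. *)
Inductive point := Vertex of 'I_n | Inner of 'I_n & 'I_n & R.

Definition is_point len (x : point) : Prop :=
  match x with
  | Vertex _ => True
  | Inner u v t => [/\ (u < v)%N, adj T u v & 0 < t < len [set u; v]]
  end.

Definition dist len (i : 'I_n) (x : point) : R :=
  match x with
  | Vertex v => vdist len i v
  | Inner u v t =>
      Num.min (vdist len i u + t) (vdist len i v + (len [set u; v] - t))
  end.

Definition two_maxian_obj w len (x1 x2 : point) : R :=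
  \sum_(i < n) w i * Num.max (dist len i x1) (dist len i x2).

Definition two_maxian w len (x1 x2 : point) : Prop :=
  [/\ is_point len x1, is_point len x2, x1 <> x2
    & forall y1 y2, is_point len y1 -> is_point len y2 -> y1 <> y2 ->
        two_maxian_obj w len y1 y2 <= two_maxian_obj w len x1 x2].

End Maxian.

Arguments Vertex {R n}.
Arguments Inner {R n}.

(** * The inverse 2-maxian problem *)

Record instance (R : realFieldType) (n : nat) (T : tree n) := Instance {
  weight : 'I_n -> R;
  len : {set 'I_n} -> R;
  bound : {set 'I_n} -> R;
  ucost : {set 'I_n} -> R;
  leafa : 'I_n;
  leafb : 'I_n;
  weight_ge0 : forall i, 0 <= weight i;
  len_ge0 : forall e, e \in edges T -> 0 <= len e;
  bound_ge0 : forall e, e \in edges T -> 0 <= bound e;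
  ucost_ge0 : forall e, e \in edges T -> 0 <= ucost e;
  leafaP : is_leaf T leafa;
  leafbP : is_leaf T leafb;
  leaf_neq : leafa != leafb }.

Section Inverse.
Variables (R : realFieldType) (n : nat) (T : tree n) (I : instance R T).
Implicit Type x : {set 'I_n} -> R.

Definition new_len x (e : {set 'I_n}) : R :=
  if e \in tree_path T (leafa I) (leafb I) then len I e + x e
  else len I e - x e.

Definition feasible x : Prop :=
  [/\ forall e, e \in edges T -> 0 <= x e <= bound I e,
      forall e, e \in edges T -> 0 <= new_len x e
    & two_maxian T (weight I) (new_len x)
        (Vertex (leafa I)) (Vertex (leafb I))].

Definition optimal (cost : ({set 'I_n} -> R) -> R) x : Prop :=
  feasible x /\ forall y, feasible y -> cost x <= cost y.

Definition l1_cost x : R := \sum_(e in edges T) ucost I e * x e.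

End Inverse.

(** * Star graphs *)

Section Star.
Variable n : nat.

Definition star_adj : rel 'I_n.+1 :=
  fun u v => (u != v) && ((u == ord0) || (v == ord0)).

Lemma star_adj_sym : symmetric star_adj.
Proof. by move=> u v; rewrite /star_adj eq_sym orbC. Qed.

Lemma star_adj_irr : irreflexive star_adj.
Proof. by move=> u; rewrite /star_adj eqxx. Qed.

Lemma star_adj_connected u v : connect star_adj u v.
Proof.
have to0 (x : 'I_n.+1) : connect star_adj x ord0.
  case: (eqVneq x ord0) => [-> | x0]; first exact: connect0.
  by apply: connect1; rewrite /star_adj x0 eqxx orbT.
have from0 (x : 'I_n.+1) : connect star_adj ord0 x.
  case: (eqVneq x ord0) => [-> | x0]; first exact: connect0.
  by apply: connect1; rewrite /star_adj eq_sym x0 eqxx.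
exact: connect_trans (to0 u) (from0 v).
Qed.

Lemma star_adj_acyclic c : ucycle star_adj c -> (size c < 3)%N.
Proof.
case: c => [|x [|y [|z c]]] //= /andP[/= /and3P[xy yz zc]].
rewrite !inE => /and3P[] /norP[xNy /norP[xNz _]] /norP[yNz yc] _.
move: xy yz; rewrite /star_adj xNy yNz /= => /orP[/eqP x0 | /eqP y0].
  by rewrite -x0 -[y == x]eq_sym -[z == x]eq_sym (negPf xNy) (negPf xNz).
move=> _; move: zc; rewrite rcons_path => /andP[_].
rewrite /star_adj -y0 (negPf xNy) orbF => /andP[_ /eqP lasty].
have := mem_last z c; rewrite lasty inE (negPf yNz) /=.
by rewrite (negPf yc).
Qed.

(* The star with the n+1 vertices v_0, ..., v_n and centre v_0. *)
Definition star : tree n.+1 :=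
  Tree star_adj_sym star_adj_irr star_adj_connected star_adj_acyclic.

Definition star_edge (i : 'I_n.+1) : {set 'I_n.+1} := [set ord0; i].

End Star.

(** * A real random access machine

    The memory consists of unbounded arrays of natural numbers (for indices
    and counters) and of elements of the field. Array names are literals, so a
    program uses finitely many arrays; the same program text serves every
    field and every instance size. Every arithmetic operation, comparison,
    connective, memory access, constant and executed command other than
    sequencing costs one unit. *)

Local Close Scope ring_scope.
Local Open Scope nat_scope.

Inductive nexp :=
  | NConst of nat
  | NGet of nat & nexp
  | NAdd of nexp & nexp
  | NSub of nexp & nexp.

Inductive rexp :=
  | RConst of nat
  | RGet of nat & nexp
  | RAdd of rexp & rexp
  | RSub of rexp & rexp
  | RMul of rexp & rexp
  | RDiv of rexp & rexp.

Inductive bexp :=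
  | NLe of nexp & nexp
  | NLt of nexp & nexp
  | RLe of rexp & rexp
  | RLt of rexp & rexp
  | BNot of bexp
  | BAnd of bexp & bexp.

Inductive cmd :=
  | Skip
  | NSet of nat & nexp & nexp
  | RSet of nat & nexp & rexp
  | Seq of cmd & cmd
  | If of bexp & cmd & cmd
  | While of bexp & cmd.

Fixpoint ncost (e : nexp) : nat :=
  match e with
  | NConst _ => 1
  | NGet _ i => (ncost i).+1
  | NAdd e1 e2 | NSub e1 e2 => (ncost e1 + ncost e2).+1
  end.

Fixpoint rcost (e : rexp) : nat :=
  match e with
  | RConst _ => 1
  | RGet _ i => (ncost i).+1
  | RAdd e1 e2 | RSub e1 e2 | RMul e1 e2 | RDiv e1 e2 =>
      (rcost e1 + rcost e2).+1
  end.

Fixpoint bcost (b : bexp) : nat :=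
  match b with
  | NLe e1 e2 | NLt e1 e2 => (ncost e1 + ncost e2).+1
  | RLe e1 e2 | RLt e1 e2 => (rcost e1 + rcost e2).+1
  | BNot b1 => (bcost b1).+1
  | BAnd b1 b2 => (bcost b1 + bcost b2).+1
  end.

Section Semantics.
Variable R : realFieldType.

(* [nmem s k i] and [rmem s k i] are the i-th cells of the k-th arrays. *)
Record state := State { nmem : nat -> nat -> nat; rmem : nat -> nat -> R }.

Definition upd (A : Type) (m : nat -> nat -> A) (k i : nat) (x : A) :=
  fun k' i' => if (k' == k) && (i' == i) then x else m k' i'.

(* Subtraction of natural numbers is truncated. *)
Fixpoint neval (s : state) (e : nexp) : nat :=
  match e with
  | NConst k => k
  | NGet k i => nmem s k (neval s i)
  | NAdd e1 e2 => neval s e1 + neval s e2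
  | NSub e1 e2 => neval s e1 - neval s e2
  end.

(* Division by zero returns zero. *)
Fixpoint reval (s : state) (e : rexp) : R :=
  match e with
  | RConst k => k%:R%R
  | RGet k i => rmem s k (neval s i)
  | RAdd e1 e2 => (reval s e1 + reval s e2)%R
  | RSub e1 e2 => (reval s e1 - reval s e2)%R
  | RMul e1 e2 => (reval s e1 * reval s e2)%R
  | RDiv e1 e2 => (reval s e1 / reval s e2)%R
  end.

Fixpoint beval (s : state) (b : bexp) : bool :=
  match b with
  | NLe e1 e2 => neval s e1 <= neval s e2
  | NLt e1 e2 => neval s e1 < neval s e2
  | RLe e1 e2 => (reval s e1 <= reval s e2)%R
  | RLt e1 e2 => (reval s e1 < reval s e2)%R
  | BNot b1 => ~~ beval s b1
  | BAnd b1 b2 => beval s b1 && beval s b2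
  end.

(* [exec c s s' t]: run from s, the command c halts in s' after t units. *)
Inductive exec : cmd -> state -> state -> nat -> Prop :=
  | ExecSkip s : exec Skip s s 1
  | ExecNSet s k i e :
      exec (NSet k i e) s
        (State (upd (nmem s) k (neval s i) (neval s e)) (rmem s))
        (ncost i + ncost e).+1
  | ExecRSet s k i e :
      exec (RSet k i e) s
        (State (nmem s) (upd (rmem s) k (neval s i) (reval s e)))
        (ncost i + rcost e).+1
  | ExecSeq c1 c2 s1 s2 s3 t1 t2 :
      exec c1 s1 s2 t1 -> exec c2 s2 s3 t2 ->
      exec (Seq c1 c2) s1 s3 (t1 + t2)
  | ExecIfTrue b c1 c2 s s' t :
      beval s b -> exec c1 s s' t ->
      exec (If b c1 c2) s s' (bcost b + t).+1
  | ExecIfFalse b c1 c2 s s' t :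
      ~~ beval s b -> exec c2 s s' t ->
      exec (If b c1 c2) s s' (bcost b + t).+1
  | ExecWhileFalse b c s :
      ~~ beval s b -> exec (While b c) s s (bcost b).+1
  | ExecWhileTrue b c s1 s2 s3 t1 t2 :
      beval s1 b -> exec c s1 s2 t1 -> exec (While b c) s2 s3 t2 ->
      exec (While b c) s1 s3 (bcost b + t1 + t2).+1.

(** Input and output conventions for the star with n+1 vertices; the edge
    v_0v_i is numbered i, and cell 0 of an edge array is unused. *)

Definition input n (I : instance R (star n)) : state :=
  let vertex_array (f : 'I_n.+1 -> R) (i : nat) :=
    if insub i is Some v then f v else 0%R in
  let edge_array (f : {set 'I_n.+1} -> R) :=
    vertex_array (fun v =>
      if star_edge v \in edges (star n) then f (star_edge v) else 0%R) in
  State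
    (fun k i =>
       match k, i with
       | 0, 0 => n.+1
       | 0, 1 => leafa I
       | 0, 2 => leafb I
       | _, _ => 0
       end)
    (fun k =>
       match k with
       | 0 => vertex_array (weight I)
       | 1 => edge_array (len I)
       | 2 => edge_array (bound I)
       | 3 => edge_array (ucost I)
       | _ => fun=> 0%R
       end).

(* Cell 0 of array 1 of natural numbers is the answer: 1 if an optimal
   solution has been written to array 4 of numbers, 0 for infeasibility. *)
Definition solved n (I : instance R (star n))
    (cost : ({set 'I_n.+1} -> R) -> R) (s : state) : Prop :=
  (nmem s 1 0 = 1 /\
    exists x : {set 'I_n.+1} -> R,
      optimal I cost x /\
      forall i : 'I_n.+1, star_edge i \in edges (star n) ->
        rmem s 4 i = x (star_edge i))
  \/ (nmem s 1 0 = 0 /\ forall x, ~ feasible I x).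

End Semantics.

(* Main.v *)
Require Import Defs.
From mathcomp Require Import all_boot all_order all_algebra.
From mathcomp Require Import lra zify.
Set Implicit Arguments.
Unset Strict Implicit.
Unset Printing Implicit Defensive.
Import Order.TTheory GRing.Theory Num.Theory.
Local Open Scope ring_scope.

(** Let the star have centre 0 and leaves 1, ..., n, let W be the total weight and
    L_i the new length of edge i.

    Feasibility. Points inside edges never beat leaves ([obj_bound]), and two
    leaves p, q have the value sum w_i L_i + max (H p q) (H q p), where
    H p q = (W - w_p) L_p + w_p L_q ([obj_leaf]). Thus {a, b} is a 2-maxian iff no
    H p q exceeds both H a b and H b a. If n > 1 and W > 0, these inequalities
    boil down to comparisons between single lengths, namely to [dominates a b] or
    [dominates b a] ([two_maxian_dominates]).

    One variable. For each of the two orders (al, be), fixing the new length z of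
    one of the two leaves determines the cheapest modification of all the other
    edges: those too long are shortened to z, and the partner is lengthened to z
    if it must be. The cost is then a sum of hinge functions c max (p - z) 0 plus
    a linear function of z, to be minimized over an interval
    ([candidate_bound], [candidate_solution]).

    Prune and search. Comparing a pivot v with the ends of the interval and with
    the sign of the slope after v tells on which side of v a minimum lies; there
    all the hinges on the other side of v are linear and can be absorbed
    ([localized_left], [localized_right]). If v has a constant fraction of the
    hinges on each side, the total time is a geometric sum ([minimize_runs]).

    Pivots. To avoid the recursion of the median of medians, the pivot is found
    bottom-up: sorted blocks are merged four by four and every second element of
    the result is dropped, so blocks double in size while the array is halved.
    Keeping one element out of two misjudges a rank by at most one element per
    block; since the blocks grow, all these errors together leave a quarter of the
    elements on each side of the final pivot, and since the array shrinks, all the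
    stages together take linear time ([stage_inv_thin], [stage_inv_end],
    [pivot_runs]).

    Programs are verified by a small logic of total correctness with running time
    ([runs], [runs_while]). *)

(** * Paths in a star *)

Section StarPaths.
Variable n : nat.
Implicit Types u v : 'I_n.+1.

Definition star_path u v : seq 'I_n.+1 :=
  if u == v then [::]
  else if (u == ord0) || (v == ord0) then [:: v] else [:: ord0; v].

Lemma simple_path_star u v p :
  simple_path (star n) u v p = (p == star_path u v).
Proof.
apply/idP/eqP => [|->]; last first.
  rewrite /simple_path /star_path /=.
  case: (eqVneq u v) => [-> /=|uv]; first by rewrite eqxx.
  case: (boolP (_ || _)) => [h|/norP[u0 v0]] /=.
    by rewrite /star_adj !inE (negPf uv) h !eqxx.
  rewrite /star_adj !inE !eqxx !orbT (negPf u0) (negPf uv).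
  by rewrite (eq_sym ord0) (negPf v0).
rewrite /star_path; case: p => [|x p] /and3P[/=].
  by move=> _ /eqP -> _; rewrite eqxx.
rewrite {1}/star_adj => /andP[/andP[ux]].
case: (eqVneq u ord0) => [u0 _|u0 /= /eqP x0].
  subst u; case: p => [|y p] /=.
    by move=> _ /eqP <- _; rewrite (negPf ux).
  rewrite {1}/star_adj => /andP[/andP[xy]].
  rewrite eq_sym (negPf ux) => /= /eqP -> _ _.
  by rewrite !inE eqxx orbT.
subst x; case: p => [|y p] /=.
  by move=> _ /eqP <- _; rewrite (negPf u0) eqxx.
rewrite {1}/star_adj => /andP[/andP[y0 _]].
case: p => [|z p] /=.
  move=> _ /eqP <- /and3P[]; rewrite !inE (negPf ux) /= => uy _ _.
  by rewrite (negPf uy) eq_sym (negPf y0).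
rewrite {1}/star_adj => /andP[/andP[yz]].
rewrite eq_sym (negPf y0) => /= /eqP -> _ _.
by rewrite !inE eqxx /= orbT andbF.
Qed.

Lemma size_star_path u v : (size (star_path u v) <= n.+1)%N.
Proof.
have : simple_path (star n) u v (star_path u v) by rewrite simple_path_star.
case/and3P=> _ _ /card_uniqP un; apply: leq_trans (leqnSn _) _.
by rewrite -[(_).+1]/(size (u :: _)) -un -[leqRHS](card_ord n.+1) max_card.
Qed.

Definition star_bseq u v : n.+1.-bseq 'I_n.+1 := Bseq (size_star_path u v).

Lemma tree_path_star u v :
  tree_path (star n) u v = path_edges u (star_path u v).
Proof.
rewrite /tree_path; case: pickP => [p|/(_ (star_bseq u v))] /=.
  by rewrite simple_path_star => /eqP ->.
by rewrite simple_path_star eqxx.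
Qed.

Lemma star_edges v : (star_edge v \in edges (star n)) = (v != ord0).
Proof.
rewrite inE; apply/existsP/idP => [[x /existsP[y /andP[/andP[xy] _ /eqP]]]|v0].
  move=> e'; apply/eqP => v0; move: e'; rewrite v0 /star_edge setUid => /setP e.
  have := e x; have := e y; rewrite !inE !eqxx orbT /= => /eqP y0 /eqP x0.
  by rewrite x0 y0 eqxx in xy.
exists ord0; apply/existsP; exists v.
by rewrite /= /star_adj eq_sym v0 eqxx /= eqxx.
Qed.

Lemma star_edge_inj u v : star_edge u = star_edge v -> u = v.
Proof.
move=> /setP e; have := e u; have := e v.
rewrite !inE !eqxx !orbT; case: (eqVneq v ord0) => [-> _|v0] /=.
  by rewrite orbb => /esym /eqP.
by move=> /eqP ->.
Qed.

Lemma edges_star e :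
  e \in edges (star n) -> exists2 v, v != ord0 & e = star_edge v.
Proof.
rewrite inE => /existsP[x /existsP[y /andP[/andP[xy]]]].
case/orP=> /eqP h /eqP ->; [exists y | exists x] => //; subst; rewrite //.
  by rewrite eq_sym.
by rewrite /star_edge setUC.
Qed.

Lemma mem_tree_path_star a b v : a != ord0 -> b != ord0 -> a != b ->
  (star_edge v \in tree_path (star n) a b) = (v == a) || (v == b).
Proof.
move=> a0 b0 ab; rewrite tree_path_star /star_path (negPf ab) (negPf a0).
rewrite (negPf b0) /= /path_edges /= !inE (setUC [set a]) -!/(star_edge _).
by congr (_ || _); apply/eqP/eqP => [|->//]; apply: star_edge_inj.
Qed.

Lemma star_leaf v : (1 < n)%N -> is_leaf (star n) v = (v != ord0).
Proof.
move=> n1; rewrite /is_leaf; case: (eqVneq v ord0) => [->|v0] /=.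
  have -> : [set u | star_adj (ord0 : 'I_n.+1) u] = [set~ ord0].
    by apply/setP => u; rewrite !inE /star_adj eqxx andbT eq_sym.
  by rewrite cardsC1 card_ord /=; apply/negbTE; lia.
have -> : [set u | star_adj v u] = [set ord0].
  apply/setP => u; rewrite !inE /star_adj (negPf v0) /=.
  by case: (eqVneq u ord0) => [->|_]; rewrite ?andbF ?v0.
by rewrite cards1.
Qed.

End StarPaths.

(** * Distances in a star *)

Section StarMetric.
Variables (R : realFieldType) (n : nat) (len : {set 'I_n.+1} -> R).
Implicit Types i u v : 'I_n.+1.

(** The distance from the centre to [v], with the convention that the centre is
    at distance 0 from itself; [len (star_edge ord0)] is not the length of an
    edge. *)
Definition arm v : R := if v == ord0 then 0 else len (star_edge v).

(** [vdist] is an arg min over simple paths; in a star there is one path to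
    choose from. *)
Lemma arg_min_uniq (I : finType) (i1 i0 : I) (P : pred I) (F : I -> R) :
  (forall k, P k = (k == i1)) -> Order.arg_min i0 P F = i1.
Proof.
move=> Pi; rewrite /Order.arg_min /extremum.
case: pickP => [i /andP[]|/(_ i1)] /=; first by rewrite Pi => /eqP.
rewrite Pi eqxx /= => /negP[]; apply/forallP => i.
by apply/implyP; rewrite Pi => /eqP ->.
Qed.

Lemma vdist_star u v :
  vdist (star n) len u v = if u == v then 0 else arm u + arm v.
Proof.
rewrite /vdist (@arg_min_uniq _ (star_bseq u v)) => [|p]; last first.
  by rewrite simple_path_star.
rewrite /path_length /= /star_path.
case: (eqVneq u v) => [_|uv]; first by rewrite big_nil.
rewrite /arm; case: (eqVneq u ord0) uv => [->|u0] uv /=.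
  by rewrite big_seq1 add0r eq_sym (negPf uv).
case: (eqVneq v ord0) => [->|v0] /=.
  by rewrite big_seq1 addr0 setUC.
by rewrite big_cons big_seq1 setUC.
Qed.

Hypothesis len0 : forall e, e \in edges (star n) -> 0 <= len e.

Lemma arm_ge0 v : 0 <= arm v.
Proof. by rewrite /arm; case: eqVneq => // v0; rewrite len0 // star_edges. Qed.

(** The uniform description of the points of a star: position [s] on the edge of
    some leaf [j]. A vertex on several edges, namely the centre, is put at
    position 0 of an arbitrary one, which is why a leaf must exist. *)
Lemma dist_star y : (0 < n)%N -> is_point (star n) len y ->
  exists j s, [/\ j != ord0, 0 <= s <= arm j &
    forall i, dist (star n) len i y = if i == j then arm j - s else arm i + s].
Proof.
move=> n0; case: y => [v|u v t] /=.
  move=> _; have [->|v0] := eqVneq v ord0.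
    pose j : 'I_n.+1 := Ordinal (n0 : (1 < n.+1)%N).
    exists j, 0; split; rewrite ?lexx ?arm_ge0 // => i.
    rewrite vdist_star; case: (eqVneq i ord0) => [->|i0]; rewrite /arm ?eqxx //.
      by rewrite addr0.
    by rewrite (negPf i0); case: eqVneq => // ->; rewrite subr0 addr0.
  exists v, (arm v); split; rewrite ?v0 ?lexx ?arm_ge0 // => i.
  by rewrite vdist_star subrr.
case=> uv /andP[_ adj] /andP[t0 tl].
have u0 : u = ord0.
  by case/orP: adj => /eqP // v0; move: uv; rewrite v0 ltn0.
subst u; have v0 : v != ord0 by apply: contraTneq uv => ->.
have av : arm v = len [set ord0; v] by rewrite /arm (negPf v0).
exists v, t; rewrite v0 av !ltW //; split=> // i; rewrite !vdist_star -av.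
have a0 : arm ord0 = 0 by rewrite /arm eqxx.
have ai := arm_ge0 i; have avp := arm_ge0 v.
case: (eqVneq i v) => [->|iv].
  by rewrite (negPf v0) a0 addr0 add0r; apply/min_idPr; lra.
by case: (eqVneq i ord0) => [->|i0]; rewrite a0 ?addr0; apply/min_idPl; lra.
Qed.

Lemma dist_star_arm j : j != ord0 -> forall i,
  dist (star n) len i (Vertex j) = if i == j then 0 else arm i + arm j.
Proof. by move=> j0 i; rewrite /= vdist_star. Qed.

End StarMetric.

(** * The 2-maxians of a star *)

Section StarMaxian.
Variables (R : realFieldType) (n : nat) (len : {set 'I_n.+1} -> R).
Variable w : 'I_n.+1 -> R.
Hypothesis w0 : forall i, 0 <= w i.
Hypothesis len0 : forall e, e \in edges (star n) -> 0 <= len e.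
Local Notation arm := (arm len).
Local Notation F := (two_maxian_obj (star n) w len).

Let W := \sum_i w i.
Let S := \sum_i w i * arm i.

(** Up to the constant [S], the objective at the leaves [p] and [q] when [p] has
    the longer edge: [p] is the farther point for all vertices but itself. *)
Definition pair_value (p q : 'I_n.+1) : R :=
  (\sum_i w i - w p) * arm p + w p * arm q.

Lemma sum_but_one j A B :
  \sum_i w i * (arm i + if i == j then B else A) = S + ((W - w j) * A + w j * B).
Proof.
rewrite (eq_bigr (fun i => w i * arm i + w i * (if i == j then B else A)));
  last by move=> i _; rewrite mulrDr.
rewrite big_split /=; congr (_ + _).
rewrite (bigD1 j) //= eqxx addrC; congr (_ + _).
have -> : W - w j = \sum_(i | i != j) w i.
  by rewrite /W (bigD1 j) //= [w j + _]addrC addrK.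
rewrite mulr_suml; by apply: eq_bigr => i /negPf ->.
Qed.

Lemma obj_sym x y : F x y = F y x.
Proof. by apply: eq_bigr => i _; rewrite maxC. Qed.

(** [pair_value p q - pair_value q p = (W - w p - w q) * (arm p - arm q)], so the
    value with the farther leaf first is the larger one. *)
Lemma obj_leaf p q : p != ord0 -> q != ord0 -> p != q ->
  F (Vertex p) (Vertex q) = S + Num.max (pair_value p q) (pair_value q p).
Proof.
wlog pq : p q / arm q <= arm p.
  move=> h p0 q0 pq; case: (lerP (arm q) (arm p)) => [/h|/ltW /h h']; first exact.
  by rewrite obj_sym maxC h' // eq_sym.
move=> p0 q0 npq.
have -> : Num.max (pair_value p q) (pair_value q p) = pair_value p q.
  apply/max_idPl; rewrite /pair_value -/W -subr_ge0.
  have : w p + w q <= W.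
    rewrite /W (bigD1 p) //= (bigD1 q) 1?eq_sym //= addrA lerDl.
    by apply: sumr_ge0.
  move: (arm p) (arm q) (w p) (w q) pq => x y wx wy xy le; nra.
rewrite /pair_value -sum_but_one; apply: eq_bigr => i _; congr (_ * _).
rewrite !dist_star_arm //.
have := arm_ge0 len0 i; have := arm_ge0 len0 p; have := arm_ge0 len0 q.
move=> aq ap ai.
case: (eqVneq i p) => [->|ip]; first by rewrite (negPf npq); apply/max_idPr; lra.
by case: (eqVneq i q) => [->|iq]; apply/max_idPl; lra.
Qed.

(** Moving a point outwards along its edge brings it closer to the leaf at the end
    of that edge only, and for this leaf the other point is the farther one. If
    both points lie on the edge of [j], the inner one is first replaced by any
    other leaf [k'], which exists since [1 < n]. *)
Lemma obj_bound y1 y2 : (1 < n)%N ->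
  is_point (star n) len y1 -> is_point (star n) len y2 ->
  exists p q, [/\ p != ord0, q != ord0, p != q & F y1 y2 <= S + pair_value p q].
Proof.
move=> n1 /(dist_star len0 (ltnW n1))[j [s [j0 js dj]]].
move=> /(dist_star len0 (ltnW n1))[k [t [k0 kt dk]]].
wlog st : y1 y2 j s j0 js dj k t k0 kt dk / t <= s.
  move=> h; case: (lerP t s) => [le|/ltW le].
    exact: (h y1 y2 j s j0 js dj k t k0 kt dk le).
  by rewrite obj_sym; apply: (h y2 y1 k t k0 kt dk j s j0 js dj le).
have [k' [k'0 k'j le]] : exists k', [/\ k' != ord0, k' != j &
    forall i, dist (star n) len i y2 <= arm i + if i == j then arm k' else arm j].
  have [ekj|nkj] := eqVneq k j; last first.
    exists k; split=> // i; rewrite dk; have ai := arm_ge0 len0 i.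
    case: (eqVneq i k) => [->|ik]; first by rewrite (negPf nkj); lra.
    by case: (eqVneq i j) => [->|ij]; lra.
  subst k.
  pose k' : 'I_n.+1 := if j == 1%N :> nat then Ordinal (n1 : (2 < n.+1)%N)
        else Ordinal (ltnW n1 : (1 < n.+1)%N).
  exists k'; split.
  - by rewrite /k'; case: ifP.
  - apply/negP => /eqP /(congr1 val); rewrite /k'.
    by case: ifP => /eqP /= e1 e2; lia.
  - move=> i; rewrite dk; have := arm_ge0 len0 i; have := arm_ge0 len0 k'.
    by case: (eqVneq i j) => [->|ij]; lra.
exists j, k'; split=> //; first by rewrite eq_sym.
rewrite /pair_value -sum_but_one; apply: ler_sum => i _.
rewrite ler_wpM2l // ge_max le andbT dj.
have := arm_ge0 len0 i; have := arm_ge0 len0 k'.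
by case: (eqVneq i j) => [->|ij]; lra.
Qed.

Lemma two_maxian_pair_value a b : (1 < n)%N ->
    a != ord0 -> b != ord0 -> a != b ->
  two_maxian (star n) w len (Vertex a) (Vertex b) <->
  (forall p q, p != ord0 -> q != ord0 -> p != q ->
     pair_value p q <= Num.max (pair_value a b) (pair_value b a)).
Proof.
move=> n1 a0 b0 ab; split.
  case=> _ _ _ h p q p0 q0 pq.
  have ne : Vertex p <> Vertex q :> point R n.+1.
    by case=> /eqP; rewrite (negPf pq).
  have := h (Vertex p) (Vertex q) I I ne; rewrite !obj_leaf // lerD2l.
  by rewrite ge_max => /andP[].
move=> h; split=> // [[/eqP]|y1 y2 p1 p2 _]; first by rewrite (negPf ab).
have [p [q [p0 q0 pq le]]] := obj_bound n1 p1 p2.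
by apply: le_trans le _; rewrite obj_leaf // lerD2l h.
Qed.

(** The solution of the inequalities [pair_value p q <= pair_value al be], up to
    an exchange of [al] and [be]. It speaks of the order of the lengths only,
    which makes the inverse problem one-dimensional. A leaf carrying the whole
    weight escapes the conditions: a point placed there is at distance 0 from
    all the weight, however long its edge is. *)
Definition dominates (al be : 'I_n.+1) : Prop :=
  let K i := [&& i != ord0, i != al, i != be & w i < \sum_i w i] in
  w al < \sum_i w i /\
  if w al <= 0
  then (w be < \sum_i w i -> arm be <= arm al) /\
       (forall i, K i -> arm i <= arm al)
  else arm be <= arm al /\ (forall i, K i -> arm i <= arm be).

Lemma w_pair p q : p != q -> w p + w q <= W.
Proof.
move=> pq; rewrite /W (bigD1 p) //= (bigD1 q) 1?eq_sym //= addrA lerDl.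
exact: sumr_ge0.
Qed.

Lemma dominates_pair_value al be : al != ord0 -> be != ord0 -> al != be ->
  dominates al be ->
  forall p q, p != ord0 -> q != ord0 -> p != q ->
    pair_value p q <= pair_value al be.
Proof.
move=> al0 be0 albe [+ d] p q p0 q0 pq; rewrite /pair_value -/W => alW.
have wal := w0 al; have wbe := w0 be; have wp := w0 p.
have aal := arm_ge0 len0 al; have abe := arm_ge0 len0 be.
have ap := arm_ge0 len0 p; have aq := arm_ge0 len0 q.
move: d; case: ifP => [wal0 [d1 d2]|/negbT]; last rewrite -ltNge.
  have -> : w al = 0 by lra.
  have main i : i != ord0 -> w i < W -> arm i <= arm al.
    move=> i0 iW; case: (eqVneq i al) => [->//|ial].
    case: (eqVneq i be) => [e|ibe]; first by subst i; apply: d1.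
    by apply: d2; rewrite i0 ial ibe.
  have pqW := w_pair pq; have wq := w0 q.
  have [pW|Wp] := ltP (w p) W; last first.
    have ep : w p = W by lra.
    have := main q q0; nra.
  have hp := main p p0 pW.
  have [qW|Wq] := ltP (w q) W; last first.
    have : w p = 0 by lra.
    move=> ->; nra.
  have := main q q0 qW; nra.
move=> wal0 [d1 d2].
have lt i : i != al -> w i < W.
  by move=> ial; have := w_pair ial; lra.
have main i : i != ord0 -> i != al -> arm i <= arm be.
  move=> i0 ial; case: (eqVneq i be) => [->//|ibe].
  by apply: d2; rewrite i0 ial ibe lt.
have [epal|pal] := eqVneq p al.
  by subst p; have := main q q0; rewrite eq_sym => /(_ pq); nra.
have hp := main p p0 pal.
have hq : arm q <= arm al.
  by case: (eqVneq q al) => [->//|qal]; have := main q q0 qal; lra.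
have := w_pair pal; nra.
Qed.

(** Each conjunct comes from one inequality: [p := al] compares [be] with the
    other leaves if [w al > 0], and [q := al] compares [p] with [al] if
    [w al = 0]. The alternative [dominates be al] is needed when
    [w al + w be = W]: then [pair_value al be = pair_value be al], and the order
    of [al] and [be] is free. *)
Lemma pair_value_dominates al be : al != ord0 -> be != ord0 -> al != be ->
  0 < W ->
  (forall p q, p != ord0 -> q != ord0 -> p != q ->
     pair_value p q <= pair_value al be) ->
  dominates al be \/ dominates be al.
Proof.
move=> al0 be0 albe Wp h.
have beal : be != al by rewrite eq_sym.
have wal := w0 al; have wbe := w0 be.
have aal := arm_ge0 len0 al; have abe := arm_ge0 len0 be.
have wab := w_pair albe.
have hab := h be al be0 al0 beal.
rewrite /dominates -/W.
move: h hab; rewrite /pair_value -/W => h hab.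
have [walz|walp] := leP (w al) 0.
  have e0 : w al = 0 by lra.
  left; split; first by rewrite e0.
  rewrite e0 in h hab *; split=> [beW|i /and4P[i0 ial ibe iW]].
    nra.
  have := h i al i0 al0 ial; have := w0 i; nra.
have lt i : i != al -> w i < W.
  by move=> ial; have := w_pair ial; lra.
have dbe i : i != ord0 -> i != al -> i != be -> arm i <= arm be.
  move=> i0 ial ibe; have := h al i al0 i0; rewrite eq_sym => /(_ ial).
  by rewrite lerD2l ler_pM2l.
have [alW|Wal] := ltP (w al) W; last first.
  have e0 : w be = 0 by lra.
  right; rewrite e0; split=> //; rewrite lexx; split; first by lra.
  by move=> i /and4P[i0 ibe ial _]; apply: dbe.
have [wbez|wbep] := leP (w be) 0.
  have e0 : w be = 0 by lra.
  left; split=> //; split; first by rewrite e0 in hab; nra.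
  by move=> i /and4P[i0 ial ibe _]; apply: dbe.
have [le|lt'] := leP (arm be) (arm al).
  left; split=> //; split=> // i /and4P[i0 ial ibe _]; exact: dbe.
(* [be] is strictly farther than [al]: all the weight is on these two leaves. *)
have eW : w al + w be = W by nra.
right; split; first by lra.
split; first exact: ltW.
move=> i /and4P[i0 ibe ial _].
have := h be i be0 i0; rewrite eq_sym => /(_ ibe).
have -> : W - w be = w al by lra.
have -> : W - w al = w be by lra.
rewrite addrC lerD2r ler_pM2l //.
Qed.

Lemma two_maxian_dominates a b : (1 < n)%N ->
    a != ord0 -> b != ord0 -> a != b -> 0 < W ->
  two_maxian (star n) w len (Vertex a) (Vertex b) <->
  dominates a b \/ dominates b a.
Proof.
move=> n1 a0 b0 ab Wp; have ba : b != a by rewrite eq_sym.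
rewrite two_maxian_pair_value //; split=> [h|[] d p q p0 q0 pq]; last first.
- by rewrite le_max orbC (dominates_pair_value b0 a0 ba d).
- by rewrite le_max (dominates_pair_value a0 b0 ab d).
have [le|/ltW le] := leP (pair_value b a) (pair_value a b).
  by rewrite (max_idPl le) in h; apply: pair_value_dominates.
rewrite (max_idPr le) in h.
by case: (pair_value_dominates b0 a0 ba Wp h); [right | left].
Qed.

End StarMaxian.

(** * Pruning a sum of hinge functions *)

Section Pruning.
Variable R : realFieldType.
Implicit Types (K z v lo hi : R) (l : seq (R * R)).

Definition excess (x : R * R) z : R := x.2 * Num.max (x.1 - z) 0.

(** The convex piecewise linear functions to be minimized: slope [K] at plus
    infinity, and a kink of size [x.2] at [x.1] for every [x] in [l]. *)
Definition hinge_sum K l z : R := K * z + \sum_(x <- l) excess x z.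

(** The invariant of the search for a minimum of [g] on [[lo0, hi0]]: nothing is
    lost by searching [[lo, hi]], where [g] agrees up to a constant with a hinge
    sum over the few hinges [l] that are still undecided. *)
Definition localized (g : R -> R) lo0 hi0 lo hi K l : Prop :=
  [/\ lo0 <= lo, lo <= hi, hi <= hi0,
      exists k, forall z, lo <= z <= hi -> g z = hinge_sum K l z + k
    & forall z, lo0 <= z <= hi0 -> exists2 z', lo <= z' <= hi & g z' <= g z].

Definition weight_above v l : R := \sum_(x <- l | v < x.1) x.2.

Lemma excess_bound v z x : 0 <= x.2 ->
  excess x v + (v - z) * (if v < x.1 then x.2 else 0) <= excess x z.
Proof.
rewrite /excess; case: x => p c /= c0.
have h : Num.max (p - v) 0 + (v - z) * (v < p)%R%:R <= Num.max (p - z) 0.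
  by case: (ltP v p) => ? /=; case: (leP (p - v) 0) => ?;
    case: (leP (p - z) 0) => ?; lra.
by case: (v < p) h => /= h; nra.
Qed.

(** [K - weight_above v l] is the slope immediately to the right of [v], hence a
    subgradient at [v]. *)
Lemma hinge_sum_slope K l v z : (forall x, x \in l -> 0 <= x.2) ->
  hinge_sum K l v <= hinge_sum K l z + (weight_above v l - K) * (z - v).
Proof.
move=> l0.
suff : \sum_(x <- l) excess x v
    <= \sum_(x <- l) excess x z + weight_above v l * (z - v).
  by rewrite /hinge_sum; lra.
have -> : weight_above v l * (z - v)
    = - \sum_(x <- l) (v - z) * (if v < x.1 then x.2 else 0).
  rewrite /weight_above big_mkcond /= -mulr_sumr; lra.
rewrite lerBrDr -big_split /= !big_seq; apply: ler_sum => x xl.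
exact: excess_bound (l0 _ xl).
Qed.

(** Left of [v], a hinge at or above [v] is linear; it moves to the slope [K] and
    to the constant. *)
Lemma localized_left g lo0 hi0 lo hi K l v :
  (forall x, x \in l -> 0 <= x.2) ->
  localized g lo0 hi0 lo hi K l ->
  (hi <= v) || (lo < v) && (weight_above v l <= K) ->
  localized g lo0 hi0 lo (Num.min hi v)
    (K - \sum_(x <- l | ~~ (x.1 < v)) x.2) [seq x <- l | x.1 < v].
Proof.
move=> l0 [h1 h2 h3 [k hk] cov] hv; split=> //.
- by rewrite le_min h2; case/orP: hv => [|/andP[/ltW //]]; apply: le_trans.
- by rewrite ge_min h3.
- exists (k + \sum_(x <- l | ~~ (x.1 < v)) x.2 * x.1) => z /andP[z1].
  rewrite le_min => /andP[z2 zv].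
  rewrite hk ?z1 // /hinge_sum big_filter (bigID (fun x => x.1 < v)) /=.
  have -> : \sum_(x <- l | ~~ (x.1 < v)) excess x z =
      \sum_(x <- l | ~~ (x.1 < v)) x.2 * x.1
      - (\sum_(x <- l | ~~ (x.1 < v)) x.2) * z.
    rewrite mulr_suml -sumrB; apply: eq_bigr => x; rewrite -leNgt => xv.
    rewrite /excess -mulrBr; congr (_ * _); apply/max_idPl.
    by rewrite subr_ge0 (le_trans zv).
  lra.
move=> z hz; have [z' /andP[z1 z2] hz'] := cov z hz.
have [zv|vz] := leP z' v; first by exists z' => //; rewrite z1 le_min z2.
case/orP: hv => [hiv|/andP[lov hw]]; first lra.
have vhi : v <= hi by lra.
exists v; first by rewrite (ltW lov) le_min vhi /=.
apply: le_trans hz'; rewrite (hk v) ?(ltW lov) ?vhi // (hk z') ?z1 ?z2 // lerD2r.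
have := hinge_sum_slope K v z' l0; nra.
Qed.

(** Right of [v], a hinge at or below [v] vanishes. *)
Lemma localized_right g lo0 hi0 lo hi K l v :
  (forall x, x \in l -> 0 <= x.2) ->
  localized g lo0 hi0 lo hi K l ->
  ~~ ((hi <= v) || (lo < v) && (weight_above v l <= K)) ->
  localized g lo0 hi0 (Num.max lo v) hi K [seq x <- l | v < x.1].
Proof.
move=> l0 [h1 h2 h3 [k hk] cov].
rewrite negb_or negb_and -ltNge -leNgt -ltNge => /andP[vhi hv]; split=> //.
- by rewrite le_max h1.
- by rewrite ge_max h2 ltW.
- exists k => z /andP[]; rewrite ge_max => /andP[z1 vz] z2.
  rewrite hk ?z1 // /hinge_sum big_filter (bigID (fun x => v < x.1)) /=.
  rewrite [X in _ + (_ + X)]big1 ?addr0 // => x; rewrite -leNgt => xv.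
  by rewrite /excess (_ : Num.max _ _ = 0) ?mulr0 //; apply/max_idPr; lra.
move=> z hz; have [z' /andP[z1 z2] hz'] := cov z hz.
have [vz|zv] := leP v z'; first by exists z' => //; rewrite ge_max z1 vz.
case/orP: hv => [hiv|hw]; first lra.
have lov : lo <= v by lra.
exists v; first by rewrite ge_max lov lexx ltW.
apply: le_trans hz'; rewrite (hk v) ?lov ?(ltW vhi) // (hk z') ?z1 ?z2 // lerD2r.
have := hinge_sum_slope K v z' l0; nra.
Qed.

Lemma localized_nil g lo0 hi0 lo hi K :
  localized g lo0 hi0 lo hi K [::] ->
  let z := if 0 <= K then lo else hi in
  lo0 <= z <= hi0 /\ forall z', lo0 <= z' <= hi0 -> g z <= g z'.
Proof.
move=> [h1 h2 h3 [k hk] cov] z.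
have /andP[z1 z2] : lo <= z <= hi by rewrite /z; case: ifP; rewrite ?h2 lexx.
split=> [|y hy]; first by rewrite (le_trans h1) // (le_trans z2).
have [y' /andP[y1 y2] hy'] := cov y hy; apply: le_trans hy'.
rewrite !hk ?y1 ?z1 // /hinge_sum !big_nil /z.
by case: (leP 0 K) => hK; nra.
Qed.

End Pruning.

(** * Approximate medians by thinned merging *)

Section Counting.
Local Open Scope nat_scope.
Variable A : Type.
Implicit Types (P : pred A) (f : nat -> A).

Fixpoint hits P f k : nat := if k is k'.+1 then hits P f k' + P (f k') else 0.

Lemma hits_add P f a b : hits P f (a + b) = hits P f a + hits P (fun t => f (a + t)) b.
Proof. by elim: b => [|b /= IH]; rewrite ?addn0 // addnS /= IH addnA. Qed.

Lemma hitsW P f a b : a <= b -> hits P f a <= hits P f b.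
Proof. by move=> /subnK <-; rewrite addnC hits_add leq_addr. Qed.

Lemma eq_hits P f g k : (forall t, t < k -> f t = g t) -> hits P f k = hits P g k.
Proof.
elim: k => [//|k IH] h /=; rewrite h // IH // => t tk; apply: h; exact: ltnW.
Qed.

Lemma hits_all P f k : (forall t, t < k -> P (f t)) -> hits P f k = k.
Proof.
by elim: k => [//|k IH] h /=; rewrite IH ?h ?addn1 // => t tk; apply: h; lia.
Qed.

End Counting.

Section Thinning.
Local Open Scope nat_scope.
Variable R : realFieldType.
Implicit Types (X : nat -> R) (v : R).

(** Sortedness of every block of [s] consecutive cells: a step [t], [t.+1] that
    is not monotone must cross a multiple of [s]. *)
Definition block_sorted s X N :=
  forall t, t.+1 < N -> ~~ (s %| t.+1) -> (X t <= X t.+1)%R.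

Local Notation below v := (fun x : R => x <= v)%R.
Local Notation above v := (fun x : R => v <= x)%R.

(** Thinning keeps the second element of every pair. If it is at most [v], so is
    the first. *)
Lemma thin_below X v u : (forall i, i < u -> (X i.*2 <= X i.*2.+1)%R) ->
  2 * hits (below v) (fun i => X i.*2.+1) u <= hits (below v) X u.*2.
Proof.
elim: u => [//|u IH] h.
rewrite doubleS /= mulnDr.
have := IH (fun i iu => h i (ltnW iu)); have := h u (ltnSn u).
case: (leP (X u.*2.+1) v) => [hv|_]; last by move=> _ /=; lia.
by move=> /le_trans/(_ hv) -> /=; lia.
Qed.

(** A kept element that is at least [v] is followed by another such element,
    except at the end of a block. *)
Lemma thin_above_block X v u :
  (forall t, t.+1 < u.+1.*2 -> (X t <= X t.+1)%R) ->
  2 * hits (above v) (fun i => X i.*2.+1) u.+1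
    <= hits (above v) X u.+1.*2 + above v (X u.*2.+1).
Proof.
elim: u => [|u IH] h; first by rewrite /=; lia.
have IH' := IH (fun t tu => h t (leq_trans tu (leqW (leqnSn _)))).
have e1 : hits (above v) X u.+2.*2 = hits (above v) X u.+1.*2
    + (v <= X u.+1.*2)%R + (v <= X u.+1.*2.+1)%R by [].
have e2 : hits (above v) (fun i => X i.*2.+1) u.+2 =
  hits (above v) (fun i => X i.*2.+1) u.+1 + (v <= X u.+1.*2.+1)%R by [].
have le : (X u.*2.+1 <= X u.+1.*2)%R by apply: h.
have {le} : (v <= X u.*2.+1)%R <= (v <= X u.+1.*2)%R.
  by case: (leP v (X u.*2.+1)) => // hv; rewrite (le_trans hv le).
rewrite e1 e2 /=; move: IH' {e1 e2} => /=.
move: (hits _ _ u) (hits _ _ u.*2) => A B.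
lia.
Qed.

Lemma thin_above X v u g : 0 < u ->
  block_sorted u.*2 X (g * u.*2) ->
  2 * hits (above v) (fun i => X i.*2.+1) (g * u) <= hits (above v) X (g * u.*2) + g.
Proof.
move=> u0; elim: g => [//|g IH] h.
rewrite !(mulSnr g) !hits_add mulnDr.
have hg := IH (fun t tg => h t (leq_trans tg (leq_mul (leqnSn _) (leqnn _)))).
case: u u0 h {IH} hg => [//|u] _ h hg.
have hb : forall t, t.+1 < u.+1.*2 ->
    (X (g * u.+1.*2 + t)%N <= X (g * u.+1.*2 + t.+1)%N)%R.
  move=> t tu; rewrite addnS; apply: h; first by rewrite mulSnr; lia.
  rewrite -addnS dvdn_addr ?dvdn_mull //.
  by apply/negP => /dvdn_leq; lia.
have {hb} := @thin_above_block (fun t => X (g * u.+1.*2 + t)) v u hb.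
rewrite (@eq_hits _ _ (fun i => X (g * u.+1.*2 + i.*2.+1))
  (fun t => X (g * u.+1 + t).*2.+1)); last first.
  by move=> t _; congr X; rewrite doubleD -doubleMr addnS.
move: (leq_b1 (above v (X (g * u.+1.*2 + u.*2.+1)))) hg => /=.
move: (hits _ _ u) (hits _ _ u.*2) (hits _ _ _) (hits _ _ _) => A B C D.
lia.
Qed.

Lemma sorted_quantile X s q : block_sorted s X s -> q < s ->
  q.+1 <= hits (below (X q)) X s /\ s - q <= hits (above (X q)) X s.
Proof.
move=> h qs.
have mono i j : i <= j -> j < s -> (X i <= X j)%R.
  move=> ij; rewrite -(subnK ij); elim: (j - i) => [//|d IH] ds.
  apply: le_trans (IH _) _; first by lia.
  by apply: h; [lia | apply/negP => /dvdn_leq; lia].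
split.
  apply: leq_trans (hitsW _ _ qs); rewrite hits_all // => t tq.
  by apply: mono; lia.
have -> : s = q + (s - q) by lia.
rewrite hits_add (@hits_all _ _ (fun t => X (q + t))); first by lia.
by move=> t tq; apply: mono; lia.
Qed.

End Thinning.

(** * The one-dimensional problem of an ordered pair of leaves *)

Section Candidates.
Variables (R : realFieldType) (n : nat) (W : R) (w l u c : nat -> R).

Local Notation leaf i := (0 < i <= n)%N.

Definition total_cost (y : nat -> R) : R := \sum_(i <- iota 1 n) c i * y i.

Section Ordered.
Variables al be : nat.

Definition other_leaf i := [&& i != al, i != be & w i < W].

Definition changed (y : nat -> R) i : R :=
  if (i == al) || (i == be) then l i + y i else l i - y i.

(** Feasible modifications for which the new lengths satisfy [dominates al be];
    the vectors are indexed by the numbers 1, ..., n of the leaves, as in the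
    memory of the machine. *)
Definition candidate (y : nat -> R) : Prop :=
  (forall i, leaf i -> 0 <= y i <= u i /\ 0 <= changed y i) /\
  (w al < W /\
   if w al <= 0
   then (w be < W -> changed y be <= changed y al) /\
        (forall i, leaf i -> other_leaf i -> changed y i <= changed y al)
   else changed y be <= changed y al /\
        (forall i, leaf i -> other_leaf i -> changed y i <= changed y be)).

(** The new length of the leaf [pinned] is the variable [z] of the
    one-dimensional problem: it bounds the lengths outside the pair, and it
    determines the cheapest choice of the remaining modifications. If
    [w al = 0] this leaf is [al], and [be] is left alone. If [w al > 0], already
    [be] has to be as far as the leaves outside the pair, and [al], which has to
    be as far as [be], is lengthened to [z] if it is shorter. *)
Definition pinned : nat := if w al <= 0 then al else be.
Definition follower : nat := if w al <= 0 then be else al.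

(** The cost [c * max (z - l) 0] of lengthening the follower is rewritten as
    [c * (z - l) + c * max (l - z) 0]; this makes it a hinge like that of a leaf
    to be shortened, adds [c] to [start_slope] and [- c * l] to [base_cost]. *)
Definition hinges : seq (R * R) :=
  (if w al <= 0 then [::] else [:: (l follower, c follower)]) ++
  [seq (l i, c i) | i <- iota 1 n & other_leaf i].

Definition start_slope : R :=
  if w al <= 0 then c pinned else c pinned + c follower.

Definition base_cost : R :=
  if w al <= 0 then - (c pinned * l pinned)
  else - (c pinned * l pinned) - c follower * l follower.

Definition solution z i : R :=
  if i == pinned then z - l pinned
  else if i == follower
  then (if w al <= 0 then 0 else Num.max (z - l follower) 0)
  else if w i < W then Num.max (l i - z) 0 else 0.

Definition lower_ok z : Prop :=
  [/\ l pinned <= z, w al <= 0 -> w be < W -> l be <= z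
    & forall i, leaf i -> other_leaf i -> l i - u i <= z].

Definition upper_ok z : Prop :=
  z <= l pinned + u pinned /\ (~~ (w al <= 0) -> z <= l al + u al).

Lemma candidate_ext y y' : leaf al -> leaf be ->
  (forall i, leaf i -> y' i = y i) -> candidate y -> candidate y'.
Proof.
move=> hal hbe e [h1 [h2 h3]].
have ec i : leaf i -> changed y' i = changed y i by move=> li; rewrite /changed e.
split=> [i li|]; first by rewrite e // ec //; apply: h1.
split=> //; move: h3; rewrite !ec //.
case: ifP => _ [h3 h4]; split=> // i li oi; rewrite ec //; exact: h4.
Qed.

Lemma total_cost_ext y y' : (forall i, leaf i -> y' i = y i) ->
  total_cost y' = total_cost y.
Proof.
move=> e; apply: eq_big_seq => i; rewrite mem_iota => li; rewrite e //; lia.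
Qed.

Hypotheses (hal : leaf al) (hbe : leaf be) (albe : al != be).
Hypotheses (c0 : forall i, leaf i -> 0 <= c i) (l0 : forall i, leaf i -> 0 <= l i).
Hypothesis u0 : forall i, leaf i -> 0 <= u i.

Lemma hinges_ge0 x : x \in hinges -> 0 <= x.2.
Proof.
rewrite mem_cat => /orP[|/mapP[i + ->]] /=.
  by case: ifP => // h; rewrite inE => /eqP -> /=; apply: c0; rewrite /follower h.
by rewrite mem_filter mem_iota => /andP[_ li]; apply: c0; lia.
Qed.

Lemma cost_split y : total_cost y = c al * y al + c be * y be +
  \sum_(i <- iota 1 n | (i != al) && (i != be)) c i * y i.
Proof.
rewrite /total_cost (bigD1_seq al) ?iota_uniq ?mem_iota //=.
rewrite -big_filter (bigD1_seq be) ?filter_uniq ?iota_uniq //=; last first.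
  by rewrite mem_filter mem_iota eq_sym albe; lia.
by rewrite addrA big_filter_cond.
Qed.

Lemma hinges_split z :
  \sum_(x <- hinges) excess x z =
  (if w al <= 0 then 0 else c al * Num.max (l al - z) 0) +
  \sum_(i <- iota 1 n | (i != al) && (i != be))
     (if w i < W then c i * Num.max (l i - z) 0 else 0).
Proof.
rewrite /hinges big_cat /= big_map big_filter; congr (_ + _).
  by rewrite /follower; case: (w al <= 0); rewrite ?big_nil ?big_seq1.
rewrite -big_mkcondr /=; apply: eq_bigl => i; by rewrite /other_leaf andbA.
Qed.

Lemma candidate_bound y : candidate y ->
  let z := changed y pinned in
  [/\ lower_ok z, upper_ok z
    & hinge_sum start_slope hinges z + base_cost <= total_cost y].
Proof.
move=> [adm [alW]]; have [/andP[ya0 yau] ya1] := adm al hal.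
have [/andP[yb0 ybu] yb1] := adm be hbe.
have ca := c0 hal; have cb := c0 hbe.
have eal : changed y al = l al + y al by rewrite /changed eqxx.
have ebe : changed y be = l be + y be by rewrite /changed eqxx orbT.
have eot i : other_leaf i -> changed y i = l i - y i.
  by rewrite /changed => /and3P[/negPf -> /negPf ->].
rewrite /lower_ok /upper_ok /hinge_sum hinges_split cost_split.
rewrite /start_slope /base_cost /pinned /follower.
have sum_le z : (forall i, leaf i -> other_leaf i -> changed y i <= z) ->
   \sum_(i <- iota 1 n | (i != al) && (i != be))
     (if w i < W then c i * Num.max (l i - z) 0 else 0) <=
   \sum_(i <- iota 1 n | (i != al) && (i != be)) c i * y i.
  move=> h; rewrite big_seq_cond [leRHS]big_seq_cond; apply: ler_sum => i.
  rewrite mem_iota => /andP[li /andP[ial ibe]].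
  have {}li : leaf i by lia.
  have [/andP[yi0 _] _] := adm i li; have ci := c0 li.
  case: ifP => iW; last exact: mulr_ge0.
  have oi : other_leaf i by rewrite /other_leaf ial ibe.
  rewrite ler_wpM2l // ge_max yi0 andbT.
  by have := h i li oi; rewrite eot //; lra.
case: ifP => wal [h1 h2]; rewrite ?eal ?ebe in h1 h2 *; split.
- split=> [|_ beW|i li oi]; first lra.
  + by have := h1 beW; lra.
  + have := h2 i li oi; rewrite eot //; have [/andP[_ yu] _] := adm i li; lra.
- by split=> //; lra.
- by have := sum_le _ h2; have := mulr_ge0 cb yb0; lra.
- split=> [|//|i li oi]; first lra.
  have := h2 i li oi; rewrite eot //; have [/andP[_ yu] _] := adm i li; lra.
- by split=> [|_]; lra.
- have := sum_le _ h2.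
  have := mulr_ge0 ca ya0.
  case: (leP (l al - (l be + y be)) 0) => h; last by lra.
  by have := ler_wpM2l ca h1; lra.
Qed.

Lemma candidate_solution z : w al < W -> lower_ok z -> upper_ok z ->
  candidate (solution z) /\
  total_cost (solution z) = hinge_sum start_slope hinges z + base_cost.
Proof.
move=> alW [low1 low2 low3] [up1 up2].
have bal : be == al = false by rewrite eq_sym (negPf albe).
have lal := l0 hal; have lbe := l0 hbe; have ual := u0 hal; have ube := u0 hbe.
have xal : solution z al = if w al <= 0 then z - l al else Num.max (z - l al) 0.
  by rewrite /solution /pinned /follower; case: (w al <= 0); rewrite ?(negPf albe) eqxx.
have xbe : solution z be = if w al <= 0 then 0 else z - l be.
  by rewrite /solution /pinned /follower; case: (w al <= 0); rewrite ?bal eqxx.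
have xot i : i != al -> i != be ->
    solution z i = if w i < W then Num.max (l i - z) 0 else 0.
  move=> /negPf ial /negPf ibe; rewrite /solution /pinned /follower.
  by case: (w al <= 0); rewrite ial ibe.
split; last first.
  rewrite cost_split /hinge_sum hinges_split /start_slope /base_cost xal xbe.
  have -> : \sum_(i <- iota 1 n | (i != al) && (i != be)) c i * solution z i =
     \sum_(i <- iota 1 n | (i != al) && (i != be))
       (if w i < W then c i * Num.max (l i - z) 0 else 0).
    apply: eq_bigr => i /andP[ial ibe]; rewrite xot //.
    by case: ifP; rewrite ?mulr0.
  rewrite /pinned /follower; case: ifP => wal; first lra.
  have -> : Num.max (z - l al) 0 = z - l al + Num.max (l al - z) 0.
    by case: (leP (z - l al) 0) => h1; case: (leP (l al - z) 0) => h2; lra.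
  lra.
have cal : changed (solution z) al =
    if w al <= 0 then z else Num.max z (l al).
  rewrite /changed eqxx xal /=; case: ifP => _; first lra.
  by case: (leP (z - l al) 0) => h1; case: (leP z (l al)) => h2; lra.
have cbe : changed (solution z) be = if w al <= 0 then l be else z.
  by rewrite /changed eqxx orbT xbe /=; case: ifP => _; lra.
have cot i : other_leaf i -> changed (solution z) i = Num.min (l i) z.
  move=> /and3P[ial ibe iW].
  rewrite /changed (negPf ial) (negPf ibe) /= xot // iW.
  by case: (leP (l i - z) 0) => h1; case: (leP (l i) z) => h2; lra.
have zge0 : 0 <= z by move: low1; rewrite /pinned; case: ifP => _; lra.
split.
  move=> i li; have li0 := l0 li; have ui0 := u0 li.
  have [->|ial] := eqVneq i al.
    rewrite cal xal; move: low1 up1 up2; rewrite /pinned.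
    case: ifP => _ h1 h2 h3; first by split; lra.
    have {}h3 := h3 isT.
    by case: (leP (z - l al) 0) => h4; case: (leP z (l al)) => h5; split; lra.
  have [->|ibe] := eqVneq i be.
    rewrite cbe xbe; move: low1 up1; rewrite /pinned.
    by case: ifP => _ h1 h2; split; lra.
  have [iW|Wi] := ltP (w i) W; last first.
    rewrite /changed (negPf ial) (negPf ibe) /= xot // ltNge Wi /=.
    by split; lra.
  have oi : other_leaf i by rewrite /other_leaf ial ibe.
  have := low3 i li oi; rewrite cot // xot // iW.
  by case: (leP (l i - z) 0) => h1; case: (leP (l i) z) => h2 h3; split; lra.
split=> //; move: low1 low2; rewrite cal cbe /pinned.
case: ifP => wal h1 h2.
  split=> [|i li oi]; first exact: h2.
  by rewrite cot // ge_min lexx orbT.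
split=> [|i li oi]; first by rewrite le_max lexx.
by rewrite cot // ge_min lexx orbT.
Qed.

End Ordered.
End Candidates.

Local Close Scope ring_scope.
Local Open Scope nat_scope.

(** * Reasoning about programs with running time *)

Fixpoint loopfree (c : cmd) : bool :=
  match c with
  | Seq c1 c2 | If _ c1 c2 => loopfree c1 && loopfree c2
  | While _ _ => false
  | _ => true
  end.

Fixpoint ccost (c : cmd) : nat :=
  match c with
  | Skip => 1
  | NSet _ i e => (ncost i + ncost e).+1
  | RSet _ i e => (ncost i + rcost e).+1
  | Seq c1 c2 => ccost c1 + ccost c2
  | If b c1 c2 => (bcost b + maxn (ccost c1) (ccost c2)).+1
  | While _ _ => 0
  end.

Fixpoint nwrites (c : cmd) : seq nat :=
  match c with
  | NSet k _ _ => [:: k]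
  | Seq c1 c2 | If _ c1 c2 => nwrites c1 ++ nwrites c2
  | While _ c1 => nwrites c1
  | _ => [::]
  end.

Fixpoint rwrites (c : cmd) : seq nat :=
  match c with
  | RSet k _ _ => [:: k]
  | Seq c1 c2 | If _ c1 c2 => rwrites c1 ++ rwrites c2
  | While _ c1 => rwrites c1
  | _ => [::]
  end.

Section Logic.
Variable R : realFieldType.
Implicit Types (s : state R) (c : cmd) (Q : state R -> Prop).

(** The final state of a loop-free command. Since it is a function, the effect of
    the body of a loop is found by computation. *)
Fixpoint srun c s : state R :=
  match c with
  | NSet k i e => State (upd (nmem s) k (neval s i) (neval s e)) (rmem s)
  | RSet k i e => State (nmem s) (upd (rmem s) k (neval s i) (reval s e))
  | Seq c1 c2 => srun c2 (srun c1 s)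
  | If b c1 c2 => if beval s b then srun c1 s else srun c2 s
  | _ => s
  end.

Lemma exec_srun c s : loopfree c ->
  exists2 t, exec c s (srun c s) t & t <= ccost c.
Proof.
elim: c s => //=.
- by move=> s _; exists 1 => //; apply: ExecSkip.
- by move=> k i e s _; eexists; first exact: ExecNSet.
- by move=> k i e s _; eexists; first exact: ExecRSet.
- move=> c1 IH1 c2 IH2 s /andP[/(IH1 s)[t1 e1 h1] /(IH2 (srun c1 s))[t2 e2 h2]].
  by eexists; [apply: ExecSeq; eassumption | apply: leq_add].
move=> b c1 IH1 c2 IH2 s /andP[/(IH1 s)[t1 e1 h1] /(IH2 s)[t2 e2 h2]].
case: ifP => [hb|/negbT hb]; eexists.
- by apply: ExecIfTrue; eassumption.
- by rewrite ltnS leq_add2l leq_max h1.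
- by apply: ExecIfFalse; eassumption.
- by rewrite ltnS leq_add2l leq_max h2 orbT.
Qed.

(** The frame condition: arrays outside [ns] and [rs] are unchanged. With the
    syntactic lists [nwrites c] and [rwrites c] it holds for every execution, so
    that no loop invariant has to mention the arrays which the loop only
    reads. *)
Definition same (ns rs : seq nat) s s' : Prop :=
  (forall k, k \notin ns -> forall i, nmem s' k i = nmem s k i) /\
  (forall k, k \notin rs -> forall i, rmem s' k i = rmem s k i).

Lemma same_refl ns rs s : same ns rs s s.
Proof. by []. Qed.

Lemma same_trans ns rs s1 s2 s3 :
  same ns rs s1 s2 -> same ns rs s2 s3 -> same ns rs s1 s3.
Proof.
by move=> [n1 r1] [n2 r2]; split=> k h i; rewrite ?n2 ?r2 ?n1 ?r1.
Qed.

Lemma same_sub ns rs ns' rs' s s' : {subset ns <= ns'} -> {subset rs <= rs'} ->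
  same ns rs s s' -> same ns' rs' s s'.
Proof.
move=> hn hr [h1 h2]; split=> k h i; [apply: h1 | apply: h2]; apply: contra h.
  exact: hn.
exact: hr.
Qed.

Lemma exec_same c s s' t : exec c s s' t -> same (nwrites c) (rwrites c) s s'.
Proof.
elim=> {c s s' t} //=.
- by move=> s k i e; split=> // k' /=; rewrite inE /upd => /negPf ->.
- by move=> s k i e; split=> // k' /=; rewrite inE /upd => /negPf ->.
- move=> c1 c2 s1 s2 s3 t1 t2 _ h1 _ h2; apply: (same_trans (s2 := s2)).
    by apply: same_sub h1 => x xin; rewrite mem_cat xin.
  by apply: same_sub h2 => x xin; rewrite mem_cat xin orbT.
- by move=> b c1 c2 s s' t _ _; apply: same_sub => x xin; rewrite mem_cat xin.
- by move=> b c1 c2 s s' t _ _; apply: same_sub => x xin; rewrite mem_cat xin orbT.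
- by move=> b c s1 s2 s3 t1 t2 _ _ h1 _ h2; apply: same_trans h1 h2.
Qed.

(** Total correctness with a time bound, for one initial state. *)
Definition runs c s (t : nat) Q : Prop :=
  exists s' t', [/\ exec c s s' t', t' <= t & Q s'].

Lemma runs_weaken c s t t' Q Q' :
  runs c s t Q -> t <= t' ->
  (forall s', same (nwrites c) (rwrites c) s s' -> Q s' -> Q' s') ->
  runs c s t' Q'.
Proof.
move=> [s' [u [e h q]]] tt' QQ'; exists s', u; split=> //.
  exact: leq_trans h _.
exact: QQ' (exec_same e) q.
Qed.

Lemma runs_loopfree c s t Q :
  loopfree c -> ccost c <= t -> Q (srun c s) -> runs c s t Q.
Proof.
move=> /(exec_srun s)[u e h] ct q; exists (srun c s), u; split=> //.
exact: leq_trans h _.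
Qed.

Lemma runs_seq c1 c2 s t1 t2 t Q1 Q :
  runs c1 s t1 Q1 ->
  (forall s1, same (nwrites c1) (rwrites c1) s s1 -> Q1 s1 -> runs c2 s1 t2 Q) ->
  t1 + t2 <= t -> runs (Seq c1 c2) s t Q.
Proof.
move=> [s1 [u1 [e1 h1 q1]]] h le.
have [s2 [u2 [e2 h2 q2]]] := h s1 (exec_same e1) q1.
exists s2, (u1 + u2); split=> //; first exact: ExecSeq e1 e2.
by apply: leq_trans le; apply: leq_add.
Qed.

Lemma runs_seq_loopfree c1 c2 s t t2 Q :
  loopfree c1 -> runs c2 (srun c1 s) t2 Q -> ccost c1 + t2 <= t ->
  runs (Seq c1 c2) s t Q.
Proof.
move=> lf h le; apply: (runs_seq (t1 := ccost c1) (Q1 := fun s1 => s1 = srun c1 s)).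
- exact: runs_loopfree.
- by move=> s1 _ ->; exact: h.
- exact: le.
Qed.

Lemma runs_if b c1 c2 s t t' Q :
  (beval s b -> runs c1 s t' Q) -> (~~ beval s b -> runs c2 s t' Q) ->
  (bcost b + t').+1 <= t ->
  runs (If b c1 c2) s t Q.
Proof.
move=> h1 h2 le; have [hb|hb] := boolP (beval s b).
  have [s' [u [e h q]]] := h1 hb; exists s', (bcost b + u).+1; split=> //.
    exact: ExecIfTrue.
  by apply: leq_trans le; rewrite ltnS leq_add2l.
have [s' [u [e h q]]] := h2 hb; exists s', (bcost b + u).+1; split=> //.
  exact: ExecIfFalse.
by apply: leq_trans le; rewrite ltnS leq_add2l.
Qed.

(** The potential [phi] pays for the body and the test of every iteration; being
    strictly decreasing, it also proves termination. *)
Lemma runs_while (phi : state R -> nat) (Inv : state R -> Prop) b c s t Q :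
  Inv s ->
  (forall s1, same (nwrites c) (rwrites c) s s1 -> Inv s1 -> beval s1 b ->
     exists k, runs c s1 k (fun s2 => Inv s2 /\ phi s2 + (bcost b + k).+1 <= phi s1)) ->
  (forall s1, same (nwrites c) (rwrites c) s s1 -> Inv s1 -> ~~ beval s1 b -> Q s1) ->
  phi s + (bcost b).+1 <= t ->
  runs (While b c) s t Q.
Proof.
move=> inv body fin le.
suff gen m s1 : phi s1 <= m -> same (nwrites c) (rwrites c) s s1 -> Inv s1 ->
    runs (While b c) s1 (phi s1 + (bcost b).+1) Q.
  have := gen _ s (leqnn _) (same_refl _ _ _) inv.
  by move=> /runs_weaken; apply.
elim: m s1 => [|m IH] s1 hm sm inv1.
all: have [hb|hb] := boolP (beval s1 b); last first.
all: try by exists s1, (bcost b).+1; split; [exact: ExecWhileFalse | lia | exact: fin].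
all: have [k [s2 [u [e hu [inv2 hphi]]]]] := body _ sm inv1 hb.
  by lia.
have hm2 : phi s2 <= m by lia.
have [s3 [u3 [e3 h3 q3]]] := IH s2 hm2 (same_trans sm (exec_same e)) inv2.
exists s3, (bcost b + u + u3).+1; split=> //; last by lia.
exact: ExecWhileTrue hb e e3.
Qed.

(** [k] pays for one iteration, and the counter [i] bounds their number. *)
Lemma runs_for (i : state R -> nat) n k (Inv : state R -> Prop) b c s t Q :
  loopfree c -> (bcost b + ccost c).+1 <= k ->
  Inv s ->
  (forall s1, same (nwrites c) (rwrites c) s s1 -> Inv s1 -> beval s1 b ->
     Inv (srun c s1) /\ i s1 < i (srun c s1) <= n) ->
  (forall s1, same (nwrites c) (rwrites c) s s1 -> Inv s1 -> ~~ beval s1 b -> Q s1) ->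
  k * (n - i s) + (bcost b).+1 <= t ->
  runs (While b c) s t Q.
Proof.
move=> lf hk inv body fin le.
apply: (runs_while (phi := fun s => k * (n - i s)) inv) fin le => s1 sm inv1 hb.
have [inv2 /andP[h1 h2]] := body _ sm inv1 hb.
exists (ccost c); apply: runs_loopfree => //; split=> //.
have : (n - i (srun c s1)).+1 <= n - i s1 by lia.
move=> /(leq_mul (leqnn k)); rewrite mulnS; lia.
Qed.

End Logic.

Declare Scope cmd_scope.
Notation "c1 ;; c2" := (Seq c1 c2)
  (at level 100, c2 at level 200, right associativity, format "c1 ;; '/' c2") : cmd_scope.
Open Scope cmd_scope.

(** * Merging two sorted blocks *)

(** The cells of an array have variable or constant indices; scalars are cells
    with a constant index. Beside the input and the output, the arrays of field
    elements are 5 and 6 for the positions and weights of the hinges, 7 and 8 for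
    the array being thinned and its scratch copy, 12 for the vector under
    construction, and 9, 10, 11, 13, 14, 15 for scalars. The arrays 2 to 9 of
    natural numbers hold scalars. *)
Notation ncell k i := (NGet k (NConst i)).
Notation rcell k i := (RGet k (NConst i)).
Notation nset k i e := (NSet k (NConst i) e).
Notation rset k i e := (RSet k (NConst i) e).
Notation nincr k i d := (NSet k (NConst i) (NAdd (NGet k (NConst i)) (NConst d))).

Notation mg_i := (ncell 3 0).
Notation mg_j := (ncell 3 1).
Notation mg_k := (ncell 3 2).
Notation mg_end := (ncell 3 3).
Notation mg_size := (ncell 3 4).
Notation mg_len := (ncell 3 5).

(** The two runs to be merged lie side by side in [X], in the [2 * mg_size] cells
    before [mg_end]; [mg_i] and [mg_j] are the reading positions and [mg_k] is
    the writing position in [Y]. When a block of [Y] is full, all of them move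
    on to the next pair of runs, so that a single loop merges the whole
    array. *)
Definition merge_step (X Y : nat) : cmd :=
  If (BAnd (NLt (NAdd mg_i mg_size) mg_end)
           (BNot (BAnd (NLt mg_j mg_end) (RLt (RGet X mg_j) (RGet X mg_i)))))
    (RSet Y mg_k (RGet X mg_i) ;; nincr 3 0 1)
    (RSet Y mg_k (RGet X mg_j) ;; nincr 3 1 1) ;;
  nincr 3 2 1 ;;
  If (NLt mg_k mg_end) Skip
    (nset 3 0 mg_k ;; nset 3 1 (NAdd mg_k mg_size) ;; nset 3 3 (NAdd mg_j mg_size)).

Definition merge_pass (X Y : nat) (sz N : nexp) : cmd :=
  (nset 3 4 sz ;; nset 3 5 N ;; nset 3 0 (NConst 0) ;; nset 3 1 mg_size ;;
   nset 3 2 (NConst 0) ;; nset 3 3 (NAdd mg_size mg_size)) ;;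
  While (NLt mg_k mg_len) (merge_step X Y).

Section Merge.
Variable R : realFieldType.
Implicit Types s : state R.

Section MergeInv.
Variables (sz M : nat) (X : nat -> R).

(** The count of [P] in the part of [X] read so far: [i] cells at the beginning
    and those between the second run's start [o + sz] and [j]; the subtraction
    is avoided by adding the first [o + sz] cells on both sides. Counting for
    every predicate stands for being a permutation. *)
Definition merge_inv (Y : nat -> R) (i j k e : nat) : Prop :=
  exists b, let o := b * (sz + sz) in
  [/\ e = o + (sz + sz), o <= k < e, o <= i <= o + sz, o + sz <= j <= e
    & [/\ k + (o + sz) = i + j, b <= M,
      forall P, hits P Y k + hits P X (o + sz) = hits P X i + hits P X j,
      block_sorted (sz + sz) Y k
    & o < k -> (i < o + sz -> (Y k.-1 <= X i)%R) /\ (j < e -> (Y k.-1 <= X j)%R)]].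

Lemma block_interior d b t : d * b < t -> t < d * b.+1 -> ~~ (d %| t).
Proof.
move=> h1 h2; apply/negP => /dvdnP[q e]; move: h1 h2; rewrite e mulnC.
by rewrite ![_ * d]mulnC; case: d e => [|d] _; rewrite ?mul0n // !ltn_pmul2l //; lia.
Qed.

Hypothesis sz0 : 0 < sz.
Hypothesis srt : block_sorted sz X (M * (sz + sz)).

(** One step of the merge; [b] tells from which of the two runs the element is
    taken. *)
Lemma merge_inv_put Y Y' i j k e (b : bool) :
  k < M * (sz + sz) ->
  merge_inv Y i j k e ->
  (if b then i + sz < e /\ (j < e -> (X i <= X j)%R)
   else j < e /\ (i + sz < e -> (X j <= X i)%R)) ->
  (forall t, t != k -> Y' t = Y t) -> Y' k = X (if b then i else j) ->
  let i' := if b then i.+1 else i in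
  let j' := if b then j else j.+1 in
  merge_inv Y' (if k.+1 < e then i' else k.+1)
               (if k.+1 < e then j' else k.+1 + sz) k.+1
               (if k.+1 < e then e else k.+1 + sz + sz).
Proof.
move=> kM [c] /=; set o := c * (sz + sz).
move=> [-> /andP[k1 k2] /andP[i1 i2] /andP[j1 j2] [kij cM cnt yS yL]].
move=> hb oth hk.
have cM' : c < M by rewrite -(@ltn_pmul2r (sz + sz)) ?addn_gt0 ?sz0 //; lia.
have eM : o + (sz + sz) <= M * (sz + sz) by rewrite -mulSnr leq_mul2r cM' orbT.
have hitsk P : hits P Y' k = hits P Y k.
  by apply: eq_hits => t tk; apply: oth; lia.
have cnt' P : hits P Y' k.+1 + hits P X (o + sz) =
    hits P X (if b then i.+1 else i) + hits P X (if b then j else j.+1).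
  by rewrite /= hitsk hk; case: b {hb hk} => /=; have := cnt P; lia.
have oe : o = sz * (2 * c) by rewrite /o; lia.
have xi : i.+1 < o + sz -> (X i <= X i.+1)%R.
  move=> h; apply: srt; first by lia.
  by apply: (@block_interior _ (2 * c)); lia.
have xj : j.+1 < o + (sz + sz) -> (X j <= X j.+1)%R.
  move=> h; apply: srt; first by lia.
  by apply: (@block_interior _ (2 * c).+1); lia.
have srt' : block_sorted (sz + sz) Y' k.+1.
  move=> t; rewrite ltnS leq_eqVlt => /orP[/eqP tk|tk] hd; last first.
    by rewrite !oth; [apply: yS | lia | lia].
  have ok : o < k.
    rewrite ltn_neqAle k1 andbT; apply: contra hd => /eqP eo.
    by rewrite tk -eo; apply/dvdnP; exists c.
  have [yi yj] := yL ok.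
  rewrite tk hk oth; last by lia.
  rewrite -tk /= in yi yj.
  by case: b hb {hk cnt'} => [] [h1 h2]; [apply: yi | apply: yj]; lia.
have [ke|ek] := ltnP k.+1 (o + (sz + sz)).
  exists c; split; rewrite -?/o //; first by lia.
  - by case: b hb {hk cnt'} => [] [h1 h2]; lia.
  - by case: b hb {hk cnt'} => [] [h1 h2]; lia.
  split=> //; first by case: b {hb hk cnt'}; lia.
  move=> _; rewrite /= hk.
  case: b hb {hk cnt'} => [] [h1 h2]; split=> h.
  - by apply: xi.
  - by apply: h2.
  - by apply: h2; lia.
  - by apply: xj.
have ke : k.+1 = o + (sz + sz) by lia.
exists c.+1; rewrite mulSnr -/o -ke; split; rewrite ?leqnn ?leq_addr //; try lia.
split=> //; try lia.
move=> P; have := cnt' P.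
have -> : (if b then i.+1 else i) = o + sz by case: b hb {hk cnt'} => [] [? ?]; lia.
have -> : (if b then j else j.+1) = k.+1 by case: b hb {hk cnt'} => [] [? ?]; lia.
lia.
Qed.

Lemma merge_inv_end Y i j e :
  merge_inv Y i j (M * (sz + sz)) e ->
  block_sorted (sz + sz) Y (M * (sz + sz)) /\
  forall P, hits P Y (M * (sz + sz)) = hits P X (M * (sz + sz)).
Proof.
move=> [c /= [-> /andP[k1 k2] /andP[i1 i2] /andP[j1 j2] [kij cM cnt yS yL]]].
have ec : c = M.
  by move: k2; rewrite -mulSnr ltn_pmul2r ?addn_gt0 ?sz0 // => k2; lia.
subst c; split=> // P; have := cnt P.
have -> : i = M * (sz + sz) by lia.
have -> : j = M * (sz + sz) + sz by lia.
by lia.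
Qed.

Lemma merge_inv_start Y : merge_inv Y 0 sz 0 (sz + sz).
Proof.
by exists 0; rewrite mul0n !add0n; split; rewrite ?addn_gt0 ?sz0 ?leqnn ?leq_addr.
Qed.

End MergeInv.

Lemma merge_pass_runs X Y (szE NE : nexp) s sz M t :
  X != Y ->
  neval s szE = sz ->
  (forall x, neval (State (upd (nmem s) 3 4 x) (rmem s)) NE = M * (sz + sz)) ->
  0 < sz -> block_sorted sz (rmem s X) (M * (sz + sz)) ->
  ncost szE + ncost NE + 60 + 80 * (M * (sz + sz)) <= t ->
  runs (merge_pass X Y szE NE) s t (fun s' =>
    block_sorted (sz + sz) (rmem s' Y) (M * (sz + sz)) /\
    forall P, hits P (rmem s' Y) (M * (sz + sz)) = hits P (rmem s X) (M * (sz + sz))).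
Proof.
move=> XY eS eN sz0 srt le.
apply: (runs_seq_loopfree (t2 := 80 * (M * (sz + sz)) + 20)) => //; last first.
  by rewrite /=; lia.
set s1 := srun _ s.
pose Inv (s' : state R) := nmem s' 3 4 = sz /\ nmem s' 3 5 = M * (sz + sz) /\
  nmem s' 3 2 <= M * (sz + sz) /\
  merge_inv sz M (rmem s X) (rmem s' Y)
    (nmem s' 3 0) (nmem s' 3 1) (nmem s' 3 2) (nmem s' 3 3).
apply: (@runs_for _ (fun s => nmem s 3 2) (M * (sz + sz)) 80 Inv).
- by [].
- by [].
- rewrite /Inv /s1 /= /upd /= eS eN; do 3 split=> //.
  exact: merge_inv_start.
- have XnY : X \notin rwrites (merge_step X Y) by rewrite /= !inE (negPf XY).
  case=> [nm rm] sm [/= hsz [hN [_ inv]]] hb; rewrite hN in hb.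
  have eX t' : rm X t' = rmem s X t' := sm.2 X XnY t'.
  rewrite /Inv /= /upd /= !addn1.
  case: (boolP (_ && ~~ _)) => hc.
  + have hc' : nm 3 0 + sz < nm 3 3 /\
        (nm 3 1 < nm 3 3 -> (rmem s X (nm 3 0) <= rmem s X (nm 3 1))%R).
      rewrite -hsz -!eX; case/andP: hc => -> hc; split=> // je.
      by move: hc; rewrite je /= -leNgt.
    have := @merge_inv_put sz M _ sz0 srt _
      (fun t => if t == nm 3 2 then rm X (nm 3 0) else rm Y t)
      _ _ _ _ true hb inv hc'.
    rewrite eqxx eX => /(_ (fun t => ifN_eq _ _) erefl).
    by rewrite /=; case: ifP => hk put; rewrite /= eqxx hN hsz /= ltnSn; do 3 split=> //.
  + have hc' : nm 3 1 < nm 3 3 /\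
        (nm 3 0 + sz < nm 3 3 -> (rmem s X (nm 3 1) <= rmem s X (nm 3 0))%R).
      rewrite -hsz -!eX. 
      have [je|ej] := ltnP (nm 3 1) (nm 3 3).
        split=> // ie; move: hc; rewrite ie je /= negbK; exact: ltW.
      case: inv => c /= [he hk hi hj [hs _ _ _ _]].
      by move: hc; rewrite hsz (ltnNge (nm 3 1)) ej /= andbT; lia.
    have := @merge_inv_put sz M _ sz0 srt _
      (fun t => if t == nm 3 2 then rm X (nm 3 1) else rm Y t)
      _ _ _ _ false hb inv hc'.
    rewrite eqxx eX => /(_ (fun t => ifN_eq _ _) erefl).
    by rewrite /=; case: ifP => hk put; rewrite /= eqxx hN hsz /= ltnSn; do 3 split=> //.
- case=> [nm rm] sm [/= hsz [hN [kN inv]]]; rewrite hN -leqNgt => Nk.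
  apply: (merge_inv_end sz0); have <- : nm 3 2 = M * (sz + sz) by lia.
  exact: inv.
- by rewrite /s1 /= /upd /=; lia.
Qed.

End Merge.

(** * Choosing a pivot in linear time *)

Notation pv_len := (ncell 2 0).
Notation pv_block := (ncell 2 1).
Notation pv_half := (ncell 2 2).
Notation pv_quarter := (ncell 2 3).
Notation th_i := (ncell 4 0).
Notation th_k := (ncell 4 1).
Notation item_count := (ncell 5 0).

Definition thin (X : nat) : cmd :=
  (nset 4 0 (NConst 0) ;; nset 4 1 (NConst 0)) ;;
  While (NLt th_k pv_len)
    (RSet X th_i (RGet X (NAdd th_k (NConst 1))) ;; nincr 4 0 1 ;; nincr 4 1 2) ;;
  nset 2 0 th_i.

(** Two passes sort blocks of four times the size; then every second element is
    dropped. The block size doubles and the length of the array is halved. *)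
Definition stage : cmd :=
  merge_pass 7 8 pv_block pv_len ;;
  merge_pass 8 7 (NAdd pv_block pv_block) pv_len ;;
  thin 7 ;;
  nset 2 3 pv_half ;; nset 2 2 pv_block ;; nset 2 1 (NAdd pv_block pv_block).

(** A copy of the first [4 ^ J] items, where [4 ^ J] is the largest power of 4 not
    exceeding their number, is thinned until a single sorted block is left. Its
    size is [2 ^ J], and the element after its first quarter is the pivot. *)
Definition pivot : cmd :=
  nset 2 0 (NConst 1) ;;
  While (NLe (NAdd (NAdd pv_len pv_len) (NAdd pv_len pv_len)) item_count)
    (nset 2 0 (NAdd (NAdd pv_len pv_len) (NAdd pv_len pv_len))) ;;
  nset 4 0 (NConst 0) ;;
  While (NLt th_i pv_len) (RSet 7 th_i (RGet 5 th_i) ;; nincr 4 0 1) ;;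
  (nset 2 1 (NConst 1) ;; nset 2 2 (NConst 0) ;; nset 2 3 (NConst 0)) ;;
  While (NLt pv_block pv_len)
    stage ;;
  rset 10 0 (RGet 7 pv_quarter).

Section Pivot.
Variable R : realFieldType.
Implicit Types s : state R.
Local Notation below v := (fun x : R => x <= v)%R.
Local Notation above v := (fun x : R => v <= x)%R.

Lemma thin_runs X s u t :
  nmem s 2 0 = u.*2 -> 50 + 50 * u <= t ->
  runs (thin X) s t (fun s' =>
    [/\ nmem s' 2 0 = u, forall i, i != 0 -> nmem s' 2 i = nmem s 2 i
      & forall i, i < u -> rmem s' X i = rmem s X i.*2.+1]).
Proof.
move=> hu ht.
apply: (runs_seq_loopfree (t2 := 40 + 50 * u)) => //; last by rewrite /=; lia.
set s1 := srun _ s.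
pose Inv (s' : state R) := [/\ nmem s' 4 1 = (nmem s' 4 0).*2,
  nmem s' 4 0 <= u, forall i, i < nmem s' 4 0 -> rmem s' X i = rmem s X i.*2.+1
  & forall i, nmem s' 4 0 <= i -> rmem s' X i = rmem s X i].
pose Q (s' : state R) := nmem s' 4 0 = u /\ Inv s'.
apply: (runs_seq (t1 := 25 + 50 * u) (t2 := 10) (Q1 := Q)); last by lia.
  apply: (@runs_for _ (fun s => nmem s 4 0) u 50 Inv) => //.
  - case=> nm rm sm [/= h1 h2 h3 h4] hb.
    have hN : nm 2 0 = u.*2 by rewrite -hu; apply: (sm.1 2 isT 0).
    rewrite /Inv /= /upd /= !addn1 !addn2 !eqxx.
    split; last by lia.
    split; first by rewrite h1 doubleS.
    + by lia.
    + move=> i; rewrite ltnS leq_eqVlt => /orP[/eqP ->|ik].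
        by rewrite eqxx h4 h1 //; lia.
      by rewrite ltn_eqF //= h3.
    + by move=> i ik; rewrite gtn_eqF //= h4 // ltnW.
  - case=> nm rm sm [/= h1 h2 h3 h4] hb.
    have hN : nm 2 0 = u.*2 by rewrite -hu; apply: (sm.1 2 isT 0).
    by split=> //=; lia.
  - by rewrite /s1 /= /upd /=; lia.
move=> s2 sm [h0 [h1 h2 h3 h4]]; apply: runs_loopfree => //=; rewrite /upd /=.
split=> // i; last by rewrite -h0; apply: h3.
by move=> /negPf ->; rewrite (sm.1 2 isT).
Qed.


(** An element of the thinned array [X] stands for [sz] elements of the original
    array [P]: the counts of elements at most [v] agree in one direction without
    any loss, those of elements at least [v] with a loss of [(N0 - N) / 2]. The
    blocks grow with the weights, so the losses of the successive stages form a
    geometric series, and their sum stays below [N0 / 2]. *)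
Definition stage_inv (P X : nat -> R) N0 N sz q1 q2 : Prop :=
  exists g,
  [/\ N = sz * 4 ^ g, N0 = sz * N, 0 < sz,
      q1.*2 <= sz <= q1.*2.+1 & 4 * q2 <= sz <= 4 * q2 + 3] /\
  [/\ block_sorted sz X N,
      forall v, sz * hits (below v) X N <= hits (below v) P N0
    & forall v, 2 * sz * hits (above v) X N <= 2 * hits (above v) P N0 + (N0 - N)].

Lemma thin_block_sorted (X : nat -> R) d g : 0 < d -> block_sorted d.*2 X (g * d.*2) ->
  block_sorted d (fun i => X i.*2.+1) (g * d).
Proof.
move=> d0 h t tg sd.
have lt : t.+1.*2.+1 < g * d.*2 by rewrite -!muln2 mulnA in tg *; lia.
apply: (@le_trans _ _ (X t.+1.*2)).
  apply: h; first by rewrite -doubleS; lia.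
  by rewrite -doubleS -!muln2 dvdn_pmul2r.
apply: h => //; apply: contra sd => dv; exfalso.
have : 2 %| t.+1.*2.+1 by apply: dvdn_trans dv; rewrite -muln2 dvdn_mull.
by rewrite dvdn2 /= odd_double.
Qed.

Lemma stage_inv_thin (P X Y T : nat -> R) N0 sz g q1 q2 :
  let N := sz * 4 ^ g.+1 in
  stage_inv P X N0 N sz q1 q2 ->
  block_sorted (4 * sz) Y N ->
  (forall p, hits p Y N = hits p X N) ->
  (forall i, i < N./2 -> T i = Y i.*2.+1) ->
  stage_inv P T N0 (sz.*2 * 4 ^ g) sz.*2 sz q1.
Proof.
move=> N [g' [[_ hN0 sz0 hq1 hq2] [hs hb ha]]] sY pY hT.
have eN : N = 4 ^ g * (sz.*2).*2 by rewrite /N expnS; lia.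
have eN2 : N./2 = 4 ^ g * sz.*2 by rewrite eN -doubleMr doubleK.
have eN3 : sz.*2 * 4 ^ g = 4 ^ g * sz.*2 by rewrite mulnC.
have s20 : 0 < sz.*2 by rewrite double_gt0.
have e4 : 4 * sz = sz.*2.*2 by lia.
rewrite e4 eN in sY.
exists g; split; first by split=> //; rewrite ?hN0 ?eN; lia.
rewrite eN3; split.
- move=> t tg sd; rewrite !hT ?eN2; [|lia|lia].
  exact: (thin_block_sorted s20 sY).
- move=> v; apply: leq_trans (hb v); rewrite -pY eN.
  rewrite (@eq_hits _ _ T (fun i => Y i.*2.+1)); last by move=> i ik; rewrite hT ?eN2.
  have hY i : i < 4 ^ g * sz.*2 -> (Y i.*2 <= Y i.*2.+1)%R.
    move=> iu; apply: sY; first by rewrite -!doubleMr in iu *; lia.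
    apply/negP => d.
    have : 2 %| i.*2.+1 by apply: dvdn_trans d; rewrite -muln2 dvdn_mull.
    by rewrite dvdn2 /= odd_double.
  have := thin_below v hY.
  by rewrite -[sz.*2]muln2 -mulnA leq_pmul2l // -!doubleMr.
- move=> v; have := ha v; rewrite -pY eN.
  rewrite (@eq_hits _ _ T (fun i => Y i.*2.+1)); last by move=> i ik; rewrite hT ?eN2.
  have /(leq_mul (leqnn sz.*2)) := thin_above v s20 sY.
  have : N <= N0 by rewrite hN0 leq_pmull.
  rewrite eN.
  move: (4 ^ g) => D; move: (hits _ Y _) => A; move: (hits _ P _) => B.
  move: (hits _ _ _) => C.
  rewrite -!muln2; nia.
Qed.

(** At the end [N0 = sz ^ 2], and the element of rank [q2], about [sz / 4], has
    at least [sz * sz / 4] elements of [P] below it and, after the loss,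
    [3 / 4 * sz * sz - N0 / 2] above it. *)
Lemma stage_inv_end (P X : nat -> R) N0 N sz q1 q2 :
  stage_inv P X N0 N sz q1 q2 -> N <= sz ->
  N0 <= 4 * hits (below (X q2)) P N0 /\ N0 <= 4 * hits (above (X q2)) P N0.
Proof.
move=> [g [[hN hN0 sz0 hq1 hq2] [hs hb ha]]] Nsz.
have eN : N = sz.
  apply/eqP; rewrite eqn_leq Nsz hN leq_pmulr // expn_gt0 //.
rewrite eN in hs hN0 hb ha.
have q2s : q2 < sz by lia.
have [h1 h2] := sorted_quantile hs q2s.
have := hb (X q2); have := ha (X q2).
move: (hits (above _) X _) (hits (above _) P _) h2 => A B h2.
move: (hits _ X _) (hits _ P _) h1 => C D h1.
by move=> ge le; split; nia.
Qed.

Lemma stage_inv_start (P X : nat -> R) J : (forall i, i < 4 ^ J -> X i = P i) ->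
  stage_inv P X (4 ^ J) (4 ^ J) 1 0 0.
Proof.
move=> h; exists J; split; first by split; rewrite ?mul1n.
split=> [t _||]; first by rewrite dvd1n.
- by move=> v; rewrite mul1n (eq_hits _ h).
- by move=> v; rewrite (eq_hits _ h); lia.
Qed.

Definition at_stage P N0 s :=
  stage_inv P (rmem s 7) N0 (nmem s 2 0) (nmem s 2 1) (nmem s 2 2) (nmem s 2 3).

Lemma stage_runs P N0 s : at_stage P N0 s -> nmem s 2 1 < nmem s 2 0 ->
  runs stage s (300 * nmem s 2 0)
    (fun s' => at_stage P N0 s' /\ (nmem s' 2 0).*2 = nmem s 2 0).
Proof.
rewrite /at_stage; set N := nmem s 2 0; set sz := nmem s 2 1 => inv sN.
have [[|g] [[eN _ sz0 _ _] [hs _ _]]] := inv; first lia.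
have eN1 : (4 ^ g * 2) * (sz + sz) = N by rewrite eN expnS; lia.
have eN2 : 4 ^ g * (sz.*2 + sz.*2) = N by rewrite eN expnS; lia.
have eN3 : (4 ^ g * sz.*2).*2 = N by rewrite eN expnS; lia.
have g0 : 0 < 4 ^ g by rewrite expn_gt0.
have N4 : 4 <= N by rewrite eN expnS; nia.
have ht1 : 70 + 80 * N + 200 * N <= 300 * N by lia.
apply: runs_seq ht1.
  apply: (@merge_pass_runs _ _ _ _ _ _ sz (4 ^ g * 2)); rewrite ?eN1 //=.
  by lia.
move=> s1 sm1; rewrite eN1 => [[sY hY]].
have e10 : nmem s1 2 0 = N := sm1.1 2 isT 0.
have e11 : nmem s1 2 1 = sz := sm1.1 2 isT 1.
have ht2 : 75 + 80 * N + 100 * N <= 200 * N by lia.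
apply: runs_seq ht2.
  apply: (@merge_pass_runs _ _ _ _ _ _ (sz.*2) (4 ^ g));
    rewrite ?eN2 //= ?e10 ?e11 ?addnn //.
  - by lia.
  - by rewrite -addnn.
  - by lia.
move=> s2 sm2; rewrite eN2 => [[sX hX]].
have e20 : nmem s2 2 0 = N by rewrite -e10; exact: (sm2.1 2 isT 0).
have ht3 : 50 + 50 * (4 ^ g * sz.*2) + 20 <= 100 * N by lia.
apply: runs_seq ht3.
  by apply: (@thin_runs _ _ (4 ^ g * sz.*2)); rewrite ?eN3 //.
move=> s3 sm3 [e30 e3 hT]; apply: runs_loopfree => //=.
rewrite /at_stage /= /upd /= e30 !e3 // addnn.
have -> : nmem s2 2 1 = sz by rewrite -e11; exact: (sm2.1 2 isT 1).
have -> : nmem s2 2 2 = nmem s 2 2.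
  by rewrite (sm2.1 2 isT 2); exact: (sm1.1 2 isT 2).
split; last by rewrite eN3.
rewrite [4 ^ g * _]mulnC; rewrite eN in inv.
apply: (stage_inv_thin (Y := rmem s2 7) inv).
- by rewrite -eN; have -> : 4 * sz = sz.*2 + sz.*2 by lia.
- by move=> p; rewrite -eN hX hY.
- by move=> i; rewrite -eN -eN3 doubleK; apply: hT.
Qed.

(** The length is halved at each stage, so the cost of all the stages is
    proportional to that of the first. The factor 16 is 4 for the quarter lost
    on each side times 4 for the items beyond the last power of 4. *)
Lemma pivot_runs s m : nmem s 5 0 = m -> 0 < m ->
  runs pivot s (900 * m) (fun s' =>
    let v := rmem s' 10 0 in
    m < 16 * hits (below v) (rmem s 5) m /\ m < 16 * hits (above v) (rmem s 5) m).
Proof.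
move=> em m0; apply: (runs_seq_loopfree (t2 := 890 * m)) => //; last by rewrite /=; lia.
pose Inv1 (s : state R) := exists2 J, nmem s 2 0 = 4 ^ J & nmem s 2 0 <= m.
apply: (runs_seq (t1 := 45 * m) (t2 := 845 * m)
   (Q1 := fun s => Inv1 s /\ m < 4 * nmem s 2 0)); last by lia.
  apply: (@runs_for _ (fun s => nmem s 2 0) m 30 Inv1) => //.
  - by exists 0.
  - case=> nm rm sm [/= J hJ hm] hb.
    have emm : nm 5 0 = m by rewrite -em; apply: (sm.1 5 isT 0).
    rewrite /Inv1 /= /upd /=; rewrite emm in hb.
    have : 0 < 4 ^ J by rewrite expn_gt0.
    by split; [exists J.+1; rewrite ?expnS; lia | lia].
  - case=> nm rm sm [/= J hJ hm] hb.
    have emm : nm 5 0 = m by rewrite -em; apply: (sm.1 5 isT 0).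
    by rewrite emm in hb; split; [exists J | rewrite /=; lia].
  - by rewrite /= /upd /=; lia.
move=> s1 sm1 [[J hJ hm1] hm2].
apply: (runs_seq_loopfree (t2 := 842 * m)) => //; last by rewrite /=; lia.
have P1 i : rmem s1 5 i = rmem s 5 i by apply: (sm1.2 5 isT).
set s2 := srun _ s1; rewrite hJ in hm1 hm2.
pose Inv2 (s : state R) := nmem s 4 0 <= 4 ^ J /\
  forall i, i < nmem s 4 0 -> rmem s 7 i = rmem s1 5 i.
apply: (runs_seq (t1 := 35 * m) (t2 := 807 * m)
  (Q1 := fun s' => nmem s' 2 0 = 4 ^ J /\
     forall i, i < 4 ^ J -> rmem s' 7 i = rmem s1 5 i)); last by lia.
  apply: (@runs_for _ (fun s => nmem s 4 0) (4 ^ J) 20 Inv2) => //.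
  - case=> nm rm sm [/= h1 h2] hb.
    have eN : nm 2 0 = 4 ^ J by rewrite -hJ; apply: (sm.1 2 isT 0).
    have e5 i : rm 5 i = rmem s1 5 i by apply: (sm.2 5 isT i).
    rewrite /Inv2 /= /upd /= !addn1; rewrite eN in hb; split; last by lia.
    split=> // i; rewrite ltnS leq_eqVlt => /orP[/eqP ->|ik].
      by rewrite eqxx e5.
    by rewrite ltn_eqF //= h2.
  - case=> nm rm sm [/= h1 h2] hb.
    have eN : nm 2 0 = 4 ^ J by rewrite -hJ; apply: (sm.1 2 isT 0).
    by split=> // i iJ; apply: h2; rewrite eN in hb; lia.
  - by rewrite /s2 /= /upd /=; lia.
move=> s3 sm3 [eN3 hX].
apply: (runs_seq_loopfree (t2 := 795 * m)) => //; last by rewrite /=; lia.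
set s4 := srun _ s3.
have inv4 : at_stage (rmem s 5) (4 ^ J) s4.
  rewrite /at_stage /s4 /= /upd /= eN3; apply: stage_inv_start => i iJ.
  by rewrite hX // P1.
apply: (runs_seq (t1 := 750 * m) (t2 := 45 * m)
  (Q1 := fun s' => at_stage (rmem s 5) (4 ^ J) s' /\ nmem s' 2 0 <= nmem s' 2 1));
  last by lia.
  apply: (@runs_while _ (fun s => 700 * nmem s 2 0) _ _ _ _ _ _ inv4).
  - move=> s5 sm5 inv5 hb; exists (300 * nmem s5 2 0).
    apply: runs_weaken (stage_runs inv5 hb) _ _ => // s6 _ [inv6 h6].
    by split=> //; rewrite -h6 /=; move: hb => /=; lia.
  - by move=> s5 sm5 inv5; rewrite /= -leqNgt.
  - by rewrite /s4 /= /upd /= eN3; lia.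
move=> s5 sm5 [inv5 le5]; apply: runs_loopfree => //; first by rewrite /=; lia.
have [h1 h2] := stage_inv_end inv5 le5.
rewrite /= /upd /=; split.
  by have := hitsW (below (rmem s5 7 (nmem s5 2 3))) (rmem s 5) hm1; lia.
by have := hitsW (above (rmem s5 7 (nmem s5 2 3))) (rmem s 5) hm1; lia.
Qed.

End Pivot.

(** * Minimizing a hinge sum in linear time *)

Notation fl_i := (ncell 6 0).
Notation fl_k := (ncell 6 1).
Notation x_slope := (rcell 9 0).
Notation x_lo := (rcell 9 1).
Notation x_hi := (rcell 9 2).
Notation x_pivot := (rcell 10 0).
Notation x_above := (rcell 10 1).

Definition sum_above : cmd :=
  (nset 6 0 (NConst 0) ;; rset 10 1 (RConst 0)) ;;
  While (NLt fl_i item_count)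
    (If (RLt x_pivot (RGet 5 fl_i)) (rset 10 1 (RAdd x_above (RGet 6 fl_i))) Skip ;;
     nincr 6 0 1).

(** With [d = 1] the weights of the dropped items are subtracted from the slope,
    as [localized_left] requires; with [d = 0] they are forgotten. *)
Definition filter_items (keep : bexp) (d : nat) : cmd :=
  (nset 6 0 (NConst 0) ;; nset 6 1 (NConst 0)) ;;
  While (NLt fl_i item_count)
    (If keep
       (RSet 5 fl_k (RGet 5 fl_i) ;; RSet 6 fl_k (RGet 6 fl_i) ;; nincr 6 1 1)
       (rset 9 0 (RSub x_slope (RMul (RConst d) (RGet 6 fl_i)))) ;;
     nincr 6 0 1) ;;
  nset 5 0 fl_k.

(** The tested condition is the negation of a conjunction because the language
    has no disjunction: [hi <= v], or [lo < v] and the slope after [v] is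
    nonnegative. *)
Definition prune_step : cmd :=
  pivot ;; sum_above ;;
  If (BNot (BAnd (BNot (RLe x_hi x_pivot))
                 (BNot (BAnd (RLt x_lo x_pivot) (RLe x_above x_slope)))))
    (If (RLt x_pivot x_hi) (rset 9 2 x_pivot) Skip ;;
     filter_items (RLt (RGet 5 fl_i) x_pivot) 1)
    (If (RLt x_lo x_pivot) (rset 9 1 x_pivot) Skip ;;
     filter_items (RLt x_pivot (RGet 5 fl_i)) 0).

Definition minimize : cmd :=
  While (NLt (NConst 0) item_count) prune_step ;;
  If (RLe (RConst 0) x_slope) (rset 11 2 x_lo) (rset 11 2 x_hi).

Section Prune.
Variable R : realFieldType.
Implicit Types s : state R.
Local Notation below v := (fun x : R => x <= v)%R.
Local Notation above v := (fun x : R => v <= x)%R.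

Definition pairs (P C : nat -> R) (m : nat) : seq (R * R) :=
  [seq (P j, C j) | j <- iota 0 m].

Definition items s : seq (R * R) := pairs (rmem s 5) (rmem s 6) (nmem s 5 0).

Lemma pairsS P C m : pairs P C m.+1 = rcons (pairs P C m) (P m, C m).
Proof. by rewrite /pairs -addn1 iotaD map_cat /= cats1. Qed.

Lemma eq_pairs P C P' C' m : (forall i, i < m -> P i = P' i) ->
  (forall i, i < m -> C i = C' i) -> pairs P C m = pairs P' C' m.
Proof.
move=> hP hC; apply/eq_in_map => i; rewrite mem_iota add0n => /andP[_ im].
by rewrite hP ?hC.
Qed.

Lemma sum_dropped_rcons (kp : pred R) l (y : R * R) :
  (\sum_(x <- rcons l y | ~~ kp x.1) x.2 =
   \sum_(x <- l | ~~ kp x.1) x.2 + (if kp y.1 then 0 else y.2))%R.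
Proof.
rewrite -cats1 big_cat big_cons big_nil /=; congr (_ + _)%R.
by case: (kp _); rewrite //= addr0.
Qed.

Lemma size_pairs P C m : size (pairs P C m) = m.
Proof. by rewrite size_map size_iota. Qed.

Lemma size_pairs_filter P C m (a b : pred R) : (forall x, a x = ~~ b x) ->
  size [seq x <- pairs P C m | a x.1] + hits b P m = m.
Proof.
move=> ab; elim: m => [//|m IH].
rewrite pairsS filter_rcons /= ab; case: (b _) => /=; rewrite ?size_rcons; lia.
Qed.

Lemma sum_above_runs s t : 50 + 50 * nmem s 5 0 <= t ->
  runs sum_above s t (fun s' => rmem s' 10 0 = rmem s 10 0 /\
    rmem s' 10 1 = weight_above (rmem s 10 0) (items s)).
Proof.
set m := nmem s 5 0 => ht.
apply: (runs_seq_loopfree (t2 := 40 + 50 * m)) => //; last by rewrite /=; lia.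
set s1 := srun _ s; set v := rmem s 10 0.
pose Inv s' := [/\ rmem s' 10 0 = v, nmem s' 6 0 <= m &
   rmem s' 10 1 = weight_above v (pairs (rmem s 5) (rmem s 6) (nmem s' 6 0))].
apply: (@runs_for _ (fun s => nmem s 6 0) m 50 Inv) => //.
- by rewrite /Inv /s1 /= /upd /=; split=> //; rewrite /weight_above big_nil.
- case=> nm rm sm [/= h1 h2 h3] hb.
  have em : nm 5 0 = m := sm.1 5 isT 0.
  have e5 i : rm 5 i = rmem s 5 i := sm.2 5 isT i.
  have e6 i : rm 6 i = rmem s 6 i := sm.2 6 isT i.
  rewrite em in hb; rewrite /Inv /= /upd /= !h1.
  have hw : weight_above v (pairs (rmem s 5) (rmem s 6) (nm 6 0).+1) =
      ((if v < rm 5 (nm 6 0)%N then rm 6 (nm 6 0)%N else 0) + rm 10 1%N)%R.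
    rewrite pairsS /weight_above -cats1 big_cat big_cons big_nil /= h3 e5 e6.
    by case: ifP => _; rewrite ?addr0 ?add0r // addrC.
  by case: ifP hw => _ hw /=; split=> //=; rewrite !addn1;
    [split=> //=; rewrite hw addrC | lia | split=> //=; rewrite hw add0r | lia].
- case=> nm rm sm [/= h1 h2 h3] hb; split=> //.
  have em : nm 5 0 = m := sm.1 5 isT 0.
  by rewrite em -leqNgt in hb; rewrite h3 /items; congr (weight_above _ (pairs _ _ _)); lia.
by rewrite /s1 /= /upd /=; lia.
Qed.

Lemma filter_items_runs keep d (kp : pred R) s t :
  bcost keep <= 10 ->
  (forall s', rmem s' 10 0 = rmem s 10 0 -> beval s' keep = kp (rmem s' 5 (nmem s' 6 0))) ->
  100 + 100 * nmem s 5 0 <= t ->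
  runs (filter_items keep d) s t (fun s' => [/\
    items s' = [seq x <- items s | kp x.1],
    rmem s' 9 0 = (rmem s 9 0 - d%:R * \sum_(x <- items s | ~~ kp x.1) x.2)%R,
    rmem s' 9 1 = rmem s 9 1 & rmem s' 9 2 = rmem s 9 2]).
Proof.
set m := nmem s 5 0 => hc hk ht.
apply: (runs_seq_loopfree (t2 := 80 + 80 * m)) => //; last by rewrite /=; lia.
set s1 := srun _ s.
pose done s' := pairs (rmem s 5) (rmem s 6) (nmem s' 6 0).
pose Inv s' := [/\ nmem s' 6 1 <= nmem s' 6 0 <= m,
   pairs (rmem s' 5) (rmem s' 6) (nmem s' 6 1) = [seq x <- done s' | kp x.1],
   forall i, nmem s' 6 0 <= i -> rmem s' 5 i = rmem s 5 i /\ rmem s' 6 i = rmem s 6 i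
   & [/\ rmem s' 9 0 = (rmem s 9 0 - d%:R * \sum_(x <- done s' | ~~ kp x.1) x.2)%R,
    rmem s' 9 1 = rmem s 9 1 & rmem s' 9 2 = rmem s 9 2]].
apply: (runs_seq (t1 := 20 + 80 * m) (t2 := 20)
  (Q1 := fun s' => Inv s' /\ nmem s' 6 0 = m)); last by lia.
  apply: (@runs_for _ (fun s => nmem s 6 0) m 80 Inv) => //.
  - by rewrite /=; lia.
  - rewrite /Inv /done /s1 /= /upd /=; split=> //.
    by rewrite /pairs /= big_nil mulr0 subr0.
  - case=> nm rm sm [/= h1 h2 h3 [h4 h5 h6]] hb.
    have em : nm 5 0 = m := sm.1 5 isT 0.
    have ev : rm 10 0 = rmem s 10 0 := sm.2 10 isT 0.
    rewrite em in hb; rewrite hk //=; have [e5 e6] := h3 _ (leqnn _).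
    rewrite /done /= in h2 h4.
    rewrite /Inv /done; case: ifP => hkp /=; rewrite /upd /= !addn1 (pairsS (rmem s 5));
      rewrite filter_rcons sum_dropped_rcons /=;
      rewrite -e5 hkp -?e6.
    + split; last by lia.
      split; first by lia.
      * rewrite -h2 pairsS !eqxx /=; congr rcons.
        by apply: eq_pairs => i ik; rewrite ltn_eqF.
      * move=> i ik; have -> : (i == nm 6 1) = false by lia.
        by apply: h3; lia.
      * by rewrite addr0.
    + split; last by lia.
      split=> //=; first by lia.
      * by move=> i ik; apply: h3; lia.
      * by rewrite h4 mulrDr opprD addrA.
  - case=> nm rm sm inv hb; split=> //.
    have em : nm 5 0 = m := sm.1 5 isT 0.
    by move: hb inv; rewrite /= em => hb [/=]; lia.
  - by rewrite /s1 /= /upd /=; lia.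
move=> s2 sm [[h1 h2 h3 [h4 h5 h6]] hm]; apply: runs_loopfree => //=.
by rewrite /items /= /upd /= h2 /done hm; split=> //; rewrite h4 /done hm.
Qed.

Section Minimize.
Variables (g : R -> R) (lo0 hi0 : R).

Definition at_localized s : Prop :=
  localized g lo0 hi0 (rmem s 9 1) (rmem s 9 2) (rmem s 9 0) (items s) /\
  (forall x, x \in items s -> 0 <= x.2)%R.

(** Ties with the pivot are dropped on either side, so at least the items counted
    in [pivot_runs] disappear. *)
Lemma prune_step_runs s : at_localized s -> 0 < nmem s 5 0 ->
  runs prune_step s (1400 * nmem s 5 0)
    (fun s' => at_localized s' /\ nmem s 5 0 + 16 * nmem s' 5 0 <= 16 * nmem s 5 0).
Proof.
set m := nmem s 5 0 => -[loc pos] m0.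
apply: (runs_seq (pivot_runs (erefl m) m0) _ (t2 := 500 * m)); last by lia.
move=> s1 sm1 [hbelow habove]; set v := rmem s1 10 0 in hbelow habove.
have em1 : nmem s1 5 0 = m := sm1.1 5 isT 0.
apply: (runs_seq (t2 := 400 * m)).
    by apply: sum_above_runs (leqnn _).
  2: by rewrite em1; lia.
move=> s2 sm2 [ev eacc].
have em2 : nmem s2 5 0 = m by rewrite -em1; exact: (sm2.1 5 isT 0).
have P2 i : rmem s2 5 i = rmem s 5 i by rewrite (sm2.2 5 isT); exact: (sm1.2 5 isT).
have C2 i : rmem s2 6 i = rmem s 6 i by rewrite (sm2.2 6 isT); exact: (sm1.2 6 isT).
have K2 i : rmem s2 9 i = rmem s 9 i by rewrite (sm2.2 9 isT); exact: (sm1.2 9 isT).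
have it2 : items s2 = items s by rewrite /items em2; apply: eq_pairs.
have it1 : items s1 = items s.
  rewrite /items em1; apply: eq_pairs => i _; first exact: (sm1.2 5 isT).
  exact: (sm1.2 6 isT).
rewrite it1 -/v in eacc; rewrite -/v in ev.
apply: (runs_if (t' := 350 * m)); last by rewrite /=; lia.
  rewrite /= negb_and !negbK eacc ev !K2 => hv.
  apply: (runs_seq_loopfree (t2 := 300 * m)) => //; last by rewrite /=; lia.
  set s3 := srun _ s2.
  have [em3 it3] : nmem s3 5 0 = m /\ items s3 = items s.
    by rewrite -it2 -em2 /s3 /=; case: ifP.
  have [k3 l3 h3] : [/\ rmem s3 9 0 = rmem s 9 0, rmem s3 9 1 = rmem s 9 1
      & rmem s3 9 2 = Num.min (rmem s 9 2) v]%R.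
    rewrite /s3 /= ev !K2; by case: ltP => h; rewrite /= /upd /= ?K2 ?ev.
  have v3 : rmem s3 10 0 = v by rewrite -ev /s3 /=; case: ifP.
  apply: runs_weaken.
  - by apply: (@filter_items_runs _ 1 (fun x => x < v)%R _ _ _ _ (leqnn _));
      rewrite // v3 => s' /= ->.
  - by rewrite em3; lia.
  move=> s4 _ [it4 k4 l4 h4]; rewrite /at_localized k4 l4 h4 it4 it3 k3 l3 h3 mul1r.
  split; first split.
  - exact: localized_left.
  - by move=> x; rewrite mem_filter => /andP[_]; apply: pos.
  have := @size_pairs_filter (rmem s 5) (rmem s 6) m (fun x => x < v)%R (above v)
    (fun x => ltNge _ _).
  have := congr1 size it4; rewrite it3 /items size_pairs -/m => ->.
  by lia.
rewrite /= negbK eacc ev !K2 -negb_or => hv.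
apply: (runs_seq_loopfree (t2 := 300 * m)) => //; last by rewrite /=; lia.
set s3 := srun _ s2.
have [em3 it3] : nmem s3 5 0 = m /\ items s3 = items s.
  by rewrite -it2 -em2 /s3 /=; case: ifP.
have [k3 h3 l3] : [/\ rmem s3 9 0 = rmem s 9 0, rmem s3 9 2 = rmem s 9 2
    & rmem s3 9 1 = Num.max (rmem s 9 1) v]%R.
  rewrite /s3 /= ev !K2; by case: ltP => h; rewrite /= /upd /= ?K2 ?ev.

have v3 : rmem s3 10 0 = v by rewrite -ev /s3 /=; case: ifP.
apply: runs_weaken.
- by apply: (@filter_items_runs _ 0 (fun x => v < x)%R _ _ _ _ (leqnn _));
    rewrite // v3 => s' /= ->.
- by rewrite em3; lia.
move=> s4 _ [it4 k4 l4 h4]; rewrite /at_localized k4 l4 h4 it4 it3 k3 l3 h3 mul0r subr0.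
split; first split.
- exact: localized_right.
- by move=> x; rewrite mem_filter => /andP[_]; apply: pos.
have := @size_pairs_filter (rmem s 5) (rmem s 6) m (fun x => v < x)%R (below v)
  (fun x => ltNge _ _).
have := congr1 size it4; rewrite it3 /items size_pairs -/m => ->.
by lia.
Qed.

(** The potential is a little more than 16 times the cost of an iteration. It is
    written as a product, like the other large constants below, to keep the
    unary literals small. *)
Lemma minimize_runs s : at_localized s ->
  runs minimize s (4520 * (5 * nmem s 5 0) + 30)
    (fun s' => let z := rmem s' 11 2 in (lo0 <= z <= hi0)%R /\
       forall z', (lo0 <= z' <= hi0 -> g z <= g z')%R).
Proof.
move=> inv.
apply: (runs_seq (t1 := 4520 * (5 * nmem s 5 0) + 10) (t2 := 20)
  (Q1 := fun s' => at_localized s' /\ nmem s' 5 0 = 0)); last by lia.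
  apply: (@runs_while _ (fun s => 4520 * (5 * nmem s 5 0)) _ _ _ _ _ _ inv).
  - move=> s1 _ inv1 m1; exists (1400 * nmem s1 5 0).
    apply: runs_weaken (prune_step_runs inv1 m1) _ _ => // s2 _ [inv2 le2].
    by split=> //; move: m1; rewrite /=; lia.
  - by move=> s1 _ inv1; rewrite /= -leqNgt leqn0 => /eqP.
  - by rewrite /=; lia.
move=> s1 _ [[loc _] m0]; apply: runs_loopfree => //.
rewrite /items m0 in loc; have := localized_nil loc.
by rewrite /=; case: ifP; rewrite /= /upd /=.
Qed.

End Minimize.
End Prune.

(** * Solving the problem of an ordered pair *)

Notation n_vertices := (ncell 0 0).
Notation n_al := (ncell 7 0).
Notation n_be := (ncell 7 1).
Notation n_pinned := (ncell 9 0).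
Notation n_follower := (ncell 9 1).
Notation n_i := (ncell 8 0).
Notation x_z := (rcell 11 2).
Notation x_weight := (rcell 13 0).
Notation x_best := (rcell 14 0).
Notation x_cost := (rcell 15 0).
Notation neq x y := (BNot (BAnd (NLe x y) (NLe y x))).
Notation test_other := (BAnd (neq n_i n_al) (BAnd (neq n_i n_be) (RLt (RGet 0 n_i) x_weight))).

Definition setup : cmd :=
  If (RLe (RGet 0 n_al) (RConst 0))
    (nset 9 0 n_al ;; nset 9 1 n_be ;; nset 5 0 (NConst 0) ;;
     rset 9 0 (RGet 3 n_pinned) ;; rset 9 1 (RGet 1 n_pinned) ;;
     rset 9 2 (RAdd (RGet 1 n_pinned) (RGet 2 n_pinned)) ;;
     If (BAnd (RLt (RGet 0 n_be) x_weight) (RLt x_lo (RGet 1 n_be))) (rset 9 1 (RGet 1 n_be)) Skip)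
    (nset 9 0 n_be ;; nset 9 1 n_al ;; nset 5 0 (NConst 1) ;;
     rset 5 0 (RGet 1 n_follower) ;; rset 6 0 (RGet 3 n_follower) ;;
     rset 9 0 (RAdd (RGet 3 n_pinned) (RGet 3 n_follower)) ;; rset 9 1 (RGet 1 n_pinned) ;;
     rset 9 2 (RAdd (RGet 1 n_pinned) (RGet 2 n_pinned)) ;;
     If (RLt (RAdd (RGet 1 n_follower) (RGet 2 n_follower)) x_hi)
       (rset 9 2 (RAdd (RGet 1 n_follower) (RGet 2 n_follower))) Skip).

Definition collect : cmd :=
  nset 8 0 (NConst 1) ;;
  While (NLt n_i n_vertices)
    (If test_other
       (RSet 5 item_count (RGet 1 n_i) ;; RSet 6 item_count (RGet 3 n_i) ;;
        nincr 5 0 1 ;;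
        If (RLt x_lo (RSub (RGet 1 n_i) (RGet 2 n_i)))
          (rset 9 1 (RSub (RGet 1 n_i) (RGet 2 n_i))) Skip)
       Skip ;;
     nincr 8 0 1).

Definition fill : cmd :=
  nset 8 0 (NConst 1) ;;
  While (NLt n_i n_vertices)
    (If (BAnd (RLt (RGet 0 n_i) x_weight) (RLt x_z (RGet 1 n_i)))
       (RSet 12 n_i (RSub (RGet 1 n_i) x_z)) (RSet 12 n_i (RConst 0)) ;;
     nincr 8 0 1) ;;
  If (BAnd (BNot (RLe (RGet 0 n_al) (RConst 0))) (RLt (RGet 1 n_follower) x_z))
    (RSet 12 n_follower (RSub x_z (RGet 1 n_follower))) (RSet 12 n_follower (RConst 0)) ;;
  RSet 12 n_pinned (RSub x_z (RGet 1 n_pinned)).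

Definition evaluate : cmd :=
  (nset 8 0 (NConst 1) ;; rset 15 0 (RConst 0)) ;;
  While (NLt n_i n_vertices)
    (rset 15 0 (RAdd x_cost (RMul (RGet 3 n_i) (RGet 12 n_i))) ;; nincr 8 0 1).

Definition record_best : cmd :=
  If (BAnd (NLe (NConst 1) (ncell 1 0)) (RLe x_best x_cost)) Skip
    ((nset 1 0 (NConst 1) ;; rset 14 0 x_cost ;; nset 8 0 (NConst 1)) ;;
     While (NLt n_i n_vertices) (RSet 4 n_i (RGet 12 n_i) ;; nincr 8 0 1)).

Definition try_order : cmd :=
  If (RLt (RGet 0 n_al) x_weight)
    (setup ;; collect ;;
     If (RLe x_lo x_hi) (minimize ;; fill ;; evaluate ;; record_best) Skip)
    Skip.

Section Round.
Variable R : realFieldType.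
Implicit Types s : state R.
Variables (n : nat) (W : R) (w l u c : nat -> R) (al be : nat).

Local Notation leaf i := (0 < i <= n).

Definition inputs s : Prop :=
  [/\ nmem s 0 0 = n.+1, nmem s 7 0 = al & nmem s 7 1 = be] /\
  [/\ forall i, rmem s 0 i = w i, forall i, rmem s 1 i = l i,
      forall i, rmem s 2 i = u i, forall i, rmem s 3 i = c i & rmem s 13 0 = W].

Lemma inputs_same ns rs s s' : same ns rs s s' ->
  all (fun k => k \notin ns) [:: 0; 7] ->
  all (fun k => k \notin rs) [:: 0; 1; 2; 3; 13] -> inputs s -> inputs s'.
Proof.
move=> sm /and3P[n0 n7 _] /and5P[r0 r1 r2 r3 /andP[r13 _]] [[h1 h2 h3] [h4 h5 h6 h7 h8]].
by split; split; try move=> i; rewrite ?(sm.1 _ n0) ?(sm.1 _ n7) ?(sm.2 _ r0)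
  ?(sm.2 _ r1) ?(sm.2 _ r2) ?(sm.2 _ r3) ?(sm.2 _ r13).
Qed.

Hypotheses (hal : leaf al) (hbe : leaf be) (albe : al != be).
Hypotheses (c0 : forall i, leaf i -> (0 <= c i)%R) (l0 : forall i, leaf i -> (0 <= l i)%R).
Hypothesis u0 : forall i, leaf i -> (0 <= u i)%R.

Local Notation pinned := (pinned w al be).
Local Notation follower := (follower w al be).
Local Notation other_leaf := (other_leaf W w al be).
Local Notation hinges := (hinges n W w l c al be).
Local Notation start_slope := (start_slope w c al be).

(** After the leaves up to [k] have been visited. The bounds of the interval are
    described by the points on their right and on their left, which avoids
    formulas for iterated maxima. *)
Definition collected k s : Prop :=
  [/\ nmem s 9 0 = pinned, nmem s 9 1 = follower,
      items s = ((if w al <= 0 then [::] else [:: (l follower, c follower)]) ++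
                 [seq (l i, c i) | i <- iota 1 k & other_leaf i])%R
    & rmem s 9 0 = start_slope] /\
  [/\ forall z, (z <= rmem s 9 2)%R <-> upper_ok w l u al be z
    & forall z, (rmem s 9 1 <= z)%R <->
       [/\ (l pinned <= z)%R, (w al <= 0)%R -> (w be < W)%R -> (l be <= z)%R
         & forall i, 0 < i <= k -> other_leaf i -> (l i - u i <= z)%R]].

Lemma setup_runs s : inputs s ->
  runs setup s 100 (fun s' => inputs s' /\ collected 0 s').
Proof.
move=> inp; apply: runs_weaken; [|exact: (leqnn 100)|move=> s' sm col; split; [exact: (inputs_same sm isT isT inp)|exact: col]].
  apply: (@runs_loopfree _ _ _ _ (collected 0)) => //.
  case: s inp => nm rm [[/= h1 h2 h3] [/= h4 h5 h6 h7 h8]].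
  rewrite /collected /items /= h2 h3 !h4 /start_slope /upper_ok /pinned /follower.
  case: ifP => wal /=.
    rewrite /upd /= h3 h4 !h5 !h6 h7 h8.
    case: (boolP (_ && _)) => hlo /=; rewrite /upd /= ?h7 ?h5 ?h6; split; split=> //= z.
    - by split=> [|[]].
    - case/andP: hlo => hb lo; split=> [h|[_ h _]]; last exact: h.
      by split=> [|_ _|i]; [lra | | lia].
    - by split=> [|[]].
    - split=> [h|[]] //; split=> // [_ hb|i]; last lia.
      by move: hlo; rewrite hb /= -leNgt => hlo; lra.
  rewrite /upd /= ?h2 ?h3 !h5 !h6 ?h7.
  case: (ltP (l al + u al) (l be + u be))%R => hlo /=; rewrite /upd /= ?h5 ?h6 ?h7;
    split; split=> //= z.
  - by split=> [h|[_ h]]; [split=> [|_]; lra | apply: h].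
  - by split=> [h|[]//]; split=> // i; lia.
  - by split=> [h|[h _]] //; split=> // _; lra.
  - by split=> [h|[]//]; split=> // i; lia.
Qed.

Lemma srun_seq c1 c2 s : srun (c1 ;; c2) s = srun c2 (srun c1 s).
Proof. by []. Qed.

Lemma iota_rcons m k : iota m k.+1 = rcons (iota m k) (m + k).
Proof. by rewrite -cats1 -[k.+1 in LHS]addn1 iotaD. Qed.

Lemma iota1S k : iota 1 k.+1 = rcons (iota 1 k) k.+1.
Proof. exact: iota_rcons. Qed.

Lemma neqE x y : ~~ ((x <= y) && (y <= x)) = (x != y).
Proof. by rewrite eqn_leq. Qed.

Lemma collect_runs s t : inputs s -> collected 0 s -> 100 * n.+1 <= t ->
  runs collect s t (fun s' => inputs s' /\ collected n s').
Proof.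
move=> inp col ht.
apply: runs_weaken; [|exact: ht|move=> s' sm col';
  split; [exact: (inputs_same sm isT isT inp)|exact: col']].
apply: (runs_seq_loopfree (t2 := 90 * n + 40)) => //; last by rewrite /=; lia.
pose Inv s' := exists2 k, nmem s' 8 0 = k.+1 /\ k <= n & collected k s'.
apply: (@runs_for _ (fun s => nmem s 8 0) n.+1 90 Inv) => //.
- by exists 0.
- move=> s1 sm [k [hi kn] hcol] hb.
  have inp1 : inputs s1 by apply: (inputs_same sm).
  case: s1 sm hi hcol hb inp1 => nm rm sm hi hcol hb [[h1 h2 h3] [h4 h5 h6 h7 h8]].
  rewrite /= in hi hb h1 h2 h3 h4 h5 h6 h7 h8.
  have kn' : k < n by rewrite hi h1 in hb.
  suff : collected k.+1 (srun (If test_other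
       (RSet 5 item_count (RGet 1 n_i) ;; RSet 6 item_count (RGet 3 n_i) ;;
        nincr 5 0 1 ;;
        If (RLt x_lo (RSub (RGet 1 n_i) (RGet 2 n_i)))
          (rset 9 1 (RSub (RGet 1 n_i) (RGet 2 n_i))) Skip)
       Skip) (State nm rm)).
         rewrite srun_seq; set s2 := srun (If _ _ _) _ => hs2.
    have e : nmem s2 8 0 = k.+1.
      by rewrite /s2 /=; case: ifP => _ //=; case: ifP.
    rewrite /Inv /= /upd /= e addn1; split; last by lia.
    by exists k.+1.
  case: hcol => [[/= g1 g2 g3 g4] [/= g5 g6]].
  rewrite /= hi !h2 !h3 !neqE h4 h8 -[_ && _]/(other_leaf k.+1).
  case: ifP => oi /=; rewrite /upd /= ?hi; last first.
    split; split=> //.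
      by rewrite iota1S filter_rcons oi; exact: g3.
    move=> z; rewrite g6; split=> -[f1 f2 f3]; split=> // i ik; last by apply: f3; lia.
    have [->|ne] := eqVneq i k.+1; first by rewrite oi.
    by apply: f3; lia.
  have it : pairs (fun i => if i == nm 5 0 then l k.+1 else rm 5 i)
     (fun i => if i == nm 5 0 then c k.+1 else rm 6 i) (nm 5 0 + 1) =
     ((if (w al <= 0)%R then [::] else [:: (l follower, c follower)]) ++
                 [seq (l i, c i) | i <- iota 1 k.+1 & other_leaf i]).
    rewrite addn1 pairsS !eqxx iota1S filter_rcons oi map_rcons -rcons_cat -g3.
    congr rcons.
    by apply: eq_pairs => i im; rewrite ltn_eqF.
  have lo z lo' : (forall z, (lo' <= z)%R <-> (rm 9%N 1%N <= z)%R /\ (l k.+1 - u k.+1 <= z)%R) ->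
    (lo' <= z)%R <->
       [/\ (l pinned <= z)%R, (w al <= 0)%R -> (w be < W)%R -> (l be <= z)%R
         & forall i, 0 < i <= k.+1 -> other_leaf i -> (l i - u i <= z)%R].
    move=> ->; rewrite g6; split=> [[[f1 f2 f3] f4]|[f1 f2 f3]].
      split=> // i ik; have [->//|ne] := eqVneq i k.+1.
      by apply: f3; lia.
    split; last by apply: f3; rewrite ?ltnSn.
    by split=> // i ik; apply: f3; lia.
  rewrite h5 h6 h7.
  case: (ltP (rm 9%N 1%N) (l k.+1 - u k.+1))%R => hlo /=;
    rewrite /upd /= ?hi ?h5 ?h6 ?h7; split; split=> //.
  - by move=> z; apply: lo => z' /=; split=> [?|[]//]; split; lra.
  - by move=> z; apply: lo => z' /=; split=> [?|[]//]; split; lra.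
- move=> s1 sm [k [hi kn] hcol] hb.
  have inp1 : inputs s1 by apply: (inputs_same sm).
  have [[e _ _] _] := inp1.
  move: hb; rewrite /= e hi ltnS -leqNgt => nk.
  by have -> : n = k by lia.
- by rewrite /= /upd /=; lia.
Qed.

Definition filled (z : R) s := forall i, leaf i -> rmem s 12 i = solution W w l al be z i.

Lemma fill_runs s t z : inputs s -> nmem s 9 0 = pinned -> nmem s 9 1 = follower ->
  rmem s 11 2 = z -> 100 * n.+1 <= t ->
  runs fill s t (filled z).
Proof.
move=> inp hp hf hz ht.
apply: (runs_seq_loopfree (t2 := 60 * n + 90)) => //; last by rewrite /=; lia.
pose val i := if (w i < W)%R then Num.max (l i - z)%R 0%R else 0%R.
pose Inv s' := exists2 k, nmem s' 8 0 = k.+1 /\ k <= n &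
  forall i, 0 < i <= k -> rmem s' 12 i = val i.
apply: (runs_seq (t1 := 60 * n + 20) (t2 := 60)
  (Q1 := fun s' => forall i, leaf i -> rmem s' 12 i = val i)); last by lia.
  apply: (@runs_for _ (fun s => nmem s 8 0) n.+1 60 Inv) => //.
  - by exists 0 => //= i; lia.
  - move=> s1 sm [k [hi kn] hx] hb.
    have inp1 : inputs s1 by apply: (inputs_same sm).
    have hz1 : rmem s1 11 2 = z by rewrite -hz; apply: (sm.2 11 isT 2).
    case: s1 sm hi hx hb inp1 hz1 => nm rm sm /= hi hx + [[/= h1 h2 h3] [/= h4 h5 h6 h7 h8]] hz1.
    rewrite hi h1 ltnS => kn'; rewrite !h4 !h8 !h5 hz1.
    case: (boolP (_ && _)) => hc /=; rewrite /Inv /= /upd /= hi; split; try lia;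
      exists k.+1; rewrite ?addn1 // => i ik; have [->|ne] := eqVneq i k.+1;
      try (by apply: hx; lia); rewrite /val ?h5 ?hz1.
    + by case/andP: hc => -> hc; rewrite (max_idPl _) // subr_ge0 ltW.
    + case: ifP hc => // _ /=; rewrite -leNgt => hc.
      by rewrite (max_idPr _) // subr_le0.
  - move=> s1 sm [k [hi kn] hx] hb.
    have inp1 : inputs s1 by apply: (inputs_same sm).
    have [[e _ _] _] := inp1.
    move: hb; rewrite /= e hi ltnS -leqNgt => nk i ik; apply: hx; lia.
  - by rewrite /= /upd /=; lia.
move=> s1 sm hx; apply: runs_loopfree => // i ik.
have inp1 : inputs s1 by apply: (inputs_same sm).
have hz1 : rmem s1 11 2 = z by rewrite -hz; apply: (sm.2 11 isT 2).
have hp1 : nmem s1 9 0 = pinned by rewrite -hp; apply: (sm.1 9 isT 0).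
have hf1 : nmem s1 9 1 = follower by rewrite -hf; apply: (sm.1 9 isT 1).
case: s1 sm hx inp1 hz1 hp1 hf1 =>
  nm rm sm /= hx [[/= h1 h2 h3] [/= h4 h5 h6 h7 h8]] hz1 hp1 hf1.
rewrite h2 h4 h5 hf1 hz1 /solution.
case: (boolP (_ && _)) => hc /=; rewrite /upd /= hp1 ?hf1 ?h5 ?hz1 (hx i ik) -/(val i);
  case: ifP => // _; case: ifP => // _.
  case/andP: hc => /negPf -> hc; rewrite (max_idPl _) // subr_ge0 ltW //.
case: ifP hc => // _ /=; rewrite -leNgt => hc.
by rewrite (max_idPr _) // subr_le0.
Qed.

Lemma evaluate_runs s t : inputs s -> 60 * n.+1 <= t ->
  runs evaluate s t (fun s' => rmem s' 15 0 = total_cost n c (rmem s 12)).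
Proof.
move=> inp ht.
apply: (runs_seq_loopfree (t2 := 50 * n + 20)) => //; last by rewrite /=; lia.
pose Inv s' := exists2 k, nmem s' 8 0 = k.+1 /\ k <= n &
  rmem s' 15 0 = total_cost k c (rmem s 12).
apply: (@runs_for _ (fun s => nmem s 8 0) n.+1 50 Inv) => //.
- by exists 0; rewrite // /total_cost big_nil.
- move=> s1 sm [k [hi kn] hx] hb.
  have inp1 : inputs s1 by apply: (inputs_same sm).
  have h12 i : rmem s1 12 i = rmem s 12 i := sm.2 12 isT i.
  case: s1 sm hi hx hb inp1 h12 => nm rm sm /= hi hx + [[/= h1 h2 h3] [/= h4 h5 h6 h7 h8]] h12.
  rewrite hi h1 ltnS => kn'; rewrite /Inv /= /upd /= ?hi; split; last lia.
  exists k.+1; rewrite ?addn1 // h7 h12 hx /total_cost iota1S.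
  by rewrite -cats1 big_cat big_seq1.
- move=> s1 sm [k [hi kn] hx] hb.
  have inp1 : inputs s1 by apply: (inputs_same sm).
  have [[e _ _] _] := inp1.
  move: hb; rewrite /= e hi ltnS -leqNgt => nk.
  by have -> : n = k by lia.
- by rewrite /= /upd /=; lia.
Qed.

Definition best_of (Q : (nat -> R) -> Prop) s : Prop :=
  (nmem s 1 0 = 0 /\ forall y, ~ Q y) \/
  (nmem s 1 0 = 1 /\ exists x,
    [/\ forall i, leaf i -> rmem s 4 i = x i, Q x, rmem s 14 0 = total_cost n c x
      & forall y, Q y -> (total_cost n c x <= total_cost n c y)%R]).

Lemma best_of_same ns rs s s' Q : same ns rs s s' ->
  1 \notin ns -> 4 \notin rs -> 14 \notin rs -> best_of Q s -> best_of Q s'.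
Proof.
move=> sm n1 r4 r14; rewrite /best_of (sm.1 _ n1) (sm.2 _ r14).
case=> [|[h [x [h1 h2 h3 h4]]]]; [by left | right; split=> //].
by exists x; split=> // i li; rewrite (sm.2 _ r4) h1.
Qed.

Lemma record_best_runs s t Q (Q' : (nat -> R) -> Prop) x : inputs s -> best_of Q s ->
  rmem s 15 0 = total_cost n c (rmem s 12) ->
  (forall i, leaf i -> rmem s 12 i = x i) ->
  Q' x -> (forall y, Q' y -> (total_cost n c x <= total_cost n c y)%R) ->
  80 * n.+1 <= t ->
  runs record_best s t (best_of (fun y => Q y \/ Q' y)).
Proof.
move=> inp best hV hx Qx xmin ht.
have ex : total_cost n c (rmem s 12) = total_cost n c x by apply: total_cost_ext.
rewrite ex in hV.
apply: (runs_if (t' := 60 * n.+1)); last by rewrite /=; lia.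
  move=> /= /andP[flag le]; apply: runs_loopfree; [by []|by rewrite [ccost _]/=; lia|rewrite /=].
  case: best => [[f0 _]|[f1 [x' [h1 h2 h3 h4]]]]; first by rewrite f0 in flag.
  right; split=> //; exists x'; split=> // [|y [/h4 //|/xmin]]; first by left.
  by apply: le_trans; rewrite -h3 -hV.
move=> hb; apply: (runs_seq_loopfree (t2 := 40 * n.+1)) => //; last by rewrite /=; lia.
pose Inv s' := exists2 k, nmem s' 8 0 = k.+1 /\ k <= n &
  forall i, 0 < i <= k -> rmem s' 4 i = x i.
apply: (@runs_for _ (fun s => nmem s 8 0) n.+1 30 Inv) => //.
- by exists 0 => //= i; lia.
- move=> s1 sm [k [hi kn] h4] hb1.
  have inp1 : inputs s1 by apply: (inputs_same sm); rewrite //; apply: inputs_same inp.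
  have h12 i : rmem s1 12 i = rmem s 12 i := sm.2 12 isT i.
  case: s1 sm hi h4 hb1 inp1 h12 => nm rm sm /= hi h4 + [[/= h1 _ _] _] h12.
  rewrite hi h1 ltnS => kn'; rewrite /Inv /= /upd /= ?hi; split; last lia.
  exists k.+1; rewrite ?addn1 // => i ik; have [->|ne] := eqVneq i k.+1.
    by rewrite h12 hx.
  by apply: h4; lia.
- move=> s1 sm [k [hi kn] h4] hb1.
  have inp1 : inputs s1 by apply: (inputs_same sm); rewrite //; apply: inputs_same inp.
  have [[e _ _] _] := inp1.
  have kn' : k = n by move: hb1; rewrite /= e hi; lia.
  right; split; first by rewrite (sm.1 1 isT).
  have e14 : rmem s1 14 0 = total_cost n c x by rewrite (sm.2 14 isT).
  exists x; rewrite kn' in h4; split=> // [|y [Qy|/xmin //]]; first by right.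
  move: hb; rewrite /=; case: best => [[_ /(_ y Qy)]//|[f1 [x' [_ _ h3 h5]]]].
  rewrite f1 /= -ltNge h3 hV => lt.
  exact: le_trans (ltW lt) (h5 y Qy).
- by rewrite /= /upd /=; lia.
Qed.

Lemma try_order_runs s t Q : inputs s -> best_of Q s -> 4700 * (5 * n.+1) <= t ->
  runs try_order s t (fun s' =>
    inputs s' /\ best_of (fun y => Q y \/ candidate n W w l u al be y) s').
Proof.
move=> inp best ht.
apply: runs_weaken; [|exact: ht|move=> s' sm best';
  split; [exact: (inputs_same sm isT isT inp)|exact: best']].
have none s' : best_of Q s' -> (forall y, ~ candidate n W w l u al be y) ->
    best_of (fun y => Q y \/ candidate n W w l u al be y) s'.
  move=> [[f0 h]|[f1 [x [h1 h2 h3 h4]]]] no.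
    by left; split=> // y [/h|/no].
  right; split=> //; exists x; split=> // [|y [/h4 //|/no //]]; by left.
have [[_ eal ebe] [ew el eu ec eW]] := inp.
apply: (runs_if (t' := 4650 * (5 * n.+1))); last by rewrite /=; lia.
all: rewrite /= eal ew eW => alW.
all: swap 1 2.
  apply: runs_loopfree; [by []|by rewrite [ccost _]/=; lia|rewrite /=].
  by apply: none => // y [_ [h _]]; rewrite h in alW.
apply: (runs_seq (setup_runs inp) _ (t2 := 4620 * (5 * n.+1))); last by lia.
move=> s1 sm1 [inp1 col1].
have best1 : best_of Q s1 by apply: (best_of_same sm1).
apply: (runs_seq (collect_runs inp1 col1 (leqnn _)) _ (t2 := 4590 * (5 * n.+1)));
  last by lia.
move=> s2 sm2 [inp2 [[hp hf hit hK] [hhi hlo]]].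
have best2 : best_of Q s2 by apply: (best_of_same sm2).
have msize : nmem s2 5 0 <= n.+1.
  rewrite -(size_pairs (rmem s2 5) (rmem s2 6) (nmem s2 5 0)) -/(items s2) hit.
  rewrite size_cat size_map size_filter.
  have := count_size other_leaf (iota 1 n); rewrite size_iota.
  by case: (w al <= 0)%R => /= cnt; [apply: leqW | rewrite add1n ltnS].
set lo := rmem s2 9 1; set hi := rmem s2 9 2.
have between y : candidate n W w l u al be y ->
    let z := changed l al be y pinned in
    (lo <= z <= hi)%R /\
    (hinge_sum start_slope hinges z + base_cost w l c al be <= total_cost n c y)%R.
  move=> cy; have [h1 h2 h3] := candidate_bound hal hbe albe c0 cy.
  by split=> //; apply/andP; split; [apply/hlo | apply/hhi].
apply: (runs_if (t' := 4580 * (5 * n.+1))); last by rewrite /=; lia.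
all: rewrite /= -/lo -/hi => lohi.
all: swap 1 2.
  apply: runs_loopfree; [by []|by rewrite [ccost _]/=; lia|rewrite /=].
  apply: none => // y /between[/andP[h1 h2] _].
  by rewrite (le_trans h1 h2) in lohi.
have loc : at_localized (hinge_sum start_slope hinges) lo hi s2.
  split; last by rewrite hit => x; apply: hinges_ge0.
  rewrite hK hit -/lo -/hi; split=> //.
    by exists 0%R => z _; rewrite addr0.
  by move=> z hz; exists z.
apply: (runs_seq (minimize_runs loc) _ (t2 := 50 * (5 * n.+1))); last by lia.
move=> s3 sm3 /=; set z := rmem s3 11 2 => -[/andP[z1 z2] zmin].
have inp3 : inputs s3 by apply: (inputs_same sm3).
have best3 : best_of Q s3 by apply: (best_of_same sm3).
have hp3 : nmem s3 9 0 = pinned by rewrite -hp; apply: (sm3.1 9 isT 0).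
have hf3 : nmem s3 9 1 = follower by rewrite -hf; apply: (sm3.1 9 isT 1).
have lz : lower_ok n W w l u al be z by apply/hlo.
have uz : upper_ok w l u al be z by apply/hhi.
have [cand cost] := candidate_solution c hal hbe albe l0 u0 alW lz uz.
apply: (runs_seq (fill_runs inp3 hp3 hf3 erefl (leqnn _)) _ (t2 := 75 * (2 * n.+1)));
  last by lia.
move=> s4 sm4 hx; have inp4 : inputs s4 by apply: (inputs_same sm4).
have best4 : best_of Q s4 by apply: (best_of_same sm4).
apply: (runs_seq (evaluate_runs inp4 (leqnn _)) _ (t2 := 80 * n.+1)); last by lia.
move=> s5 sm5 hV; have inp5 : inputs s5 by apply: (inputs_same sm5).
have best5 : best_of Q s5 by apply: (best_of_same sm5).
have h12 i : rmem s5 12 i = rmem s4 12 i := sm5.2 12 isT i.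
apply: (record_best_runs inp5 best5 _ _ cand _ (leqnn _)).
- by rewrite hV; apply: eq_bigr => i _; rewrite h12.
- by move=> i li; rewrite h12; apply: hx.
- by move=> y /between[hz]; apply: le_trans; rewrite cost lerD2r; apply: zmin.
Qed.

End Round.

(** * The algorithm *)

(** With at most one edge, or without any positive weight, the lengths may stay as
    they are. Otherwise both orders of the two prescribed leaves are tried. *)
Definition solver : cmd :=
  If (NLe n_vertices (NConst 2)) (nset 1 0 (NConst 1))
    ((rset 13 0 (RConst 0) ;; nset 8 0 (NConst 0)) ;;
     While (NLt n_i n_vertices) (rset 13 0 (RAdd x_weight (RGet 0 n_i)) ;; nincr 8 0 1) ;;
     If (RLe x_weight (RConst 0)) (nset 1 0 (NConst 1))
       ((nset 7 0 (ncell 0 1) ;; nset 7 1 (ncell 0 2)) ;; try_order ;;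
        (nset 7 0 (ncell 0 2) ;; nset 7 1 (ncell 0 1)) ;; try_order)).

Section Bridge.
Variables (R : realFieldType) (n : nat) (I : instance R (star n)).
Local Notation a := (leafa I).
Local Notation b := (leafb I).
Local Notation leaf i := (0 < i <= n).
Local Notation w := (rmem (input I) 0).
Local Notation l := (rmem (input I) 1).
Local Notation u := (rmem (input I) 2).
Local Notation c := (rmem (input I) 3).
Local Notation W := (\sum_i weight I i)%R.

Lemma weight_input (v : 'I_n.+1) : w v = weight I v.
Proof. by rewrite /= valK. Qed.

Lemma edge_input (v : 'I_n.+1) : v != ord0 ->
  [/\ l v = len I (star_edge v), u v = bound I (star_edge v)
    & c v = ucost I (star_edge v)].
Proof. by move=> v0; rewrite /= valK star_edges v0. Qed.

Lemma leaf_ord (v : 'I_n.+1) : leaf v = (v != ord0).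
Proof. by have := ltn_ord v; rewrite ltnS => ->; rewrite andbT lt0n. Qed.

Lemma leafE i : leaf i -> exists2 v : 'I_n.+1, v != ord0 & i = v.
Proof.
move=> /andP[i0 iN]; exists (Ordinal (iN : i < n.+1)) => //.
by rewrite -leaf_ord /= i0 iN.
Qed.

Lemma input_ge0 i : leaf i -> [/\ 0 <= l i, 0 <= u i & 0 <= c i]%R.
Proof.
move=> /leafE[v v0 ->]; have [-> -> ->] := edge_input v0.
by split; [apply: len_ge0 | apply: bound_ge0 | apply: ucost_ge0]; rewrite star_edges.
Qed.

Definition vector_of (x : {set 'I_n.+1} -> R) (i : nat) : R :=
  x (star_edge (inord i)).

(** The inverse of [vector_of], on edges. *)
Definition edge_function (y : nat -> R) (e : {set 'I_n.+1}) : R :=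
  if [pick v | (v != ord0) && (e == star_edge v)] is Some v then y v else 0%R.

Lemma vector_of_ord x (v : 'I_n.+1) : vector_of x v = x (star_edge v).
Proof. by rewrite /vector_of inord_val. Qed.

Lemma edge_functionE y (v : 'I_n.+1) : v != ord0 -> edge_function y (star_edge v) = y v.
Proof.
move=> v0; rewrite /edge_function; case: pickP => [v' /andP[_ /eqP]|/(_ v)].
  by move=> /star_edge_inj ->.
by rewrite v0 eqxx.
Qed.

Lemma total_cost_l1 x : l1_cost I x = total_cost n c (vector_of x).
Proof.
rewrite /l1_cost /total_cost.
have -> : (\sum_(i <- iota 1 n) c i * vector_of x i =
    \sum_(1 <= i < n.+1) c i * vector_of x i)%R.
  by rewrite /index_iota subSS subn0.
have -> : edges (star n) = [set star_edge v | v in [set v | v != ord0]].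
  apply/setP => e; apply/idP/imsetP => [/edges_star[v v0 ->]|[v + ->]].
    by exists v; rewrite ?inE.
  by rewrite inE star_edges.
rewrite big_imset /=; last by move=> v1 v2 _ _; apply: star_edge_inj.
rewrite big_add1 /= big_mkord (eq_bigl (fun v => v != ord0)); last by move=> v; rewrite inE.
rewrite big_mkcond big_ord_recl /= add0r; apply: eq_bigr => i _.
have v0 : lift ord0 i != ord0 by [].
have [_ _ e] := edge_input v0.
by rewrite -e -vector_of_ord lift0.
Qed.

Lemma total_weight : (\sum_(i <- iota 0 n.+1) w i)%R = W.
Proof.
have -> : (\sum_(i <- iota 0 n.+1) w i = \sum_(0 <= i < n.+1) w i)%R.
  by rewrite /index_iota subn0.
by rewrite big_mkord; apply: eq_bigr => i _; rewrite weight_input.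
Qed.

Section ManyLeaves.
Hypothesis n1 : 1 < n.

Lemma leaf_a : a != ord0. Proof. by rewrite -star_leaf // leafaP. Qed.
Lemma leaf_b : b != ord0. Proof. by rewrite -star_leaf // leafbP. Qed.

Lemma changed_new_len al be x (v : 'I_n.+1) :
  (al = a /\ be = b) \/ (al = b /\ be = a) -> v != ord0 ->
  changed l al be (vector_of x) v = new_len I x (star_edge v).
Proof.
move=> ab v0; rewrite /changed /new_len vector_of_ord.
rewrite mem_tree_path_star ?leaf_a ?leaf_b ?leaf_neq //.
have [-> _ _] := edge_input v0.
by case: ab => -[-> ->]; rewrite -!val_eqE //= orbC.
Qed.

Lemma dominates_candidate al be x :
  (al = a /\ be = b) \/ (al = b /\ be = a) ->
  (forall e, e \in edges (star n) -> 0 <= x e <= bound I e)%R ->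
  (forall e, e \in edges (star n) -> 0 <= new_len I x e)%R ->
  dominates (new_len I x) (weight I) al be <->
  candidate n W w l u al be (vector_of x).
Proof.
move=> ab h1 h2.
have [al0 be0] : al != ord0 /\ be != ord0.
  by case: ab => -[-> ->]; rewrite leaf_a leaf_b.
have arm_ch v : v != ord0 -> arm (new_len I x) v = changed l al be (vector_of x) v.
  by move=> v0; rewrite changed_new_len // /arm (negPf v0).
have adm i : leaf i -> (0 <= vector_of x i <= u i)%R /\
    (0 <= changed l al be (vector_of x) i)%R.
  move=> /leafE[v v0 ->]; rewrite changed_new_len // vector_of_ord.
  by have [_ -> _] := edge_input v0; rewrite h1 ?h2 ?star_edges.
rewrite /dominates /candidate !arm_ch // !weight_input.
have allE z :
  (forall i, [&& i != ord0, i != al, i != be & (weight I i < W)%R] ->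
     (arm (new_len I x) i <= z)%R) <->
  (forall i, leaf i -> other_leaf W w al be i -> (changed l al be (vector_of x) i <= z)%R).
  split=> h i.
    move=> /leafE[v v0 ->] /and3P[va vb]; rewrite weight_input => vW.
    by rewrite -arm_ch //; apply: h; rewrite v0 va vb.
  move=> /and4P[v0 va vb vW]; rewrite arm_ch //; apply: h; rewrite ?leaf_ord //.
  by rewrite /other_leaf weight_input va vb vW.
case: ifP => _; rewrite !allE; tauto.
Qed.

Lemma feasible_candidate x : (0 < W)%R ->
  feasible I x <->
  candidate n W w l u a b (vector_of x) \/ candidate n W w l u b a (vector_of x).
Proof.
move=> W0.
have key : (forall e, e \in edges (star n) -> 0 <= x e <= bound I e)%R ->
  (forall e, e \in edges (star n) -> 0 <= new_len I x e)%R ->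
  two_maxian (star n) (weight I) (new_len I x) (Vertex a) (Vertex b) <->
  candidate n W w l u a b (vector_of x) \/ candidate n W w l u b a (vector_of x).
  move=> h1 h2; rewrite two_maxian_dominates ?leaf_a ?leaf_b ?leaf_neq //; last first.
    by move=> i; apply: weight_ge0.
  by rewrite !dominates_candidate //; [right | left].
split=> [[h1 h2 h3]|h]; first exact/key.
have [h1 h2] : (forall e, e \in edges (star n) -> 0 <= x e <= bound I e)%R /\
  (forall e, e \in edges (star n) -> 0 <= new_len I x e)%R.
  split=> e /edges_star[v v0 ->].
    rewrite -vector_of_ord; have [_ <- _] := edge_input v0.
    have lv : leaf v by rewrite leaf_ord.
    by case: h => -[/(_ v lv)[]].
  have lv : leaf v by rewrite leaf_ord.
  by case: h => -[/(_ v lv)[_]]; rewrite changed_new_len //; [left | right].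
by split=> //; apply/key.
Qed.

Lemma feasible_weightless : (W <= 0)%R -> feasible I (fun=> 0%R).
Proof.
move=> W0.
have w0 i : weight I i = 0%R.
  have /eqP : W == 0%R by rewrite eq_le W0 sumr_ge0 // => j _; apply: weight_ge0.
  by move/psumr_eq0P => -> // j _; apply: weight_ge0.
split=> [e he|e he|]; rewrite ?lexx ?bound_ge0 //.
  by rewrite /new_len subr0 addr0 if_same len_ge0.
split=> // [[/eqP]|y1 y2 _ _ _]; first by rewrite (negPf (leaf_neq I)).
by rewrite /two_maxian_obj !big1 // => i _; rewrite w0 mul0r.
Qed.

End ManyLeaves.

(** A single edge: no two points are farther apart than its ends [a] and [b]. *)
Lemma feasible_edge : n <= 1 -> feasible I (fun=> 0%R).
Proof.
move=> n1; have ab := leaf_neq I.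
have n0 : 0 < n.
  rewrite lt0n; apply: contra ab => /eqP n0; apply/eqP/val_inj.
  by have := ltn_ord a; have := ltn_ord b; rewrite /=; lia.
have lenE e : new_len I (fun=> 0%R) e = len I e.
  by rewrite /new_len subr0 addr0 if_same.
have len0 e : e \in edges (star n) -> (0 <= new_len I (fun=> 0) e)%R.
  by rewrite lenE; apply: len_ge0.
split=> // [e he|]; first by rewrite lexx bound_ge0.
split=> // [[/eqP]|y1 y2 p1 p2 _]; first by rewrite (negPf ab).
apply: ler_sum => i _; apply: ler_wpM2l; first exact: weight_ge0.
set L := new_len I _ in len0 *.
pose v : 'I_n.+1 := Ordinal (n0 : 1 < n.+1).
have ordE (j : 'I_n.+1) : j = ord0 \/ j = v.
  have := ltn_ord j; case: (posnP j) => j0 jn.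
    by left; apply: val_inj.
  by right; apply: val_inj => /=; lia.
have a0 : arm L ord0 = 0%R by rewrite /arm eqxx.
have av := arm_ge0 len0 v.
have le y : is_point (star n) L y -> (dist (star n) L i y <= arm L v)%R.
  move=> /(dist_star len0 n0)[j [s [j0 /andP[s0 s1] ->]]].
  have jv : j = v by case: (ordE j) => // e; rewrite e eqxx in j0.
  subst j; case: (eqVneq i v) => [_|iv]; first lra.
  have -> : i = ord0 by case: (ordE i) => // e; rewrite e eqxx in iv.
  by rewrite a0 add0r.
rewrite ge_max !(le_trans (le _ _)) //=; rewrite !vdist_star le_max.
  all: case: (ordE i) (ordE a) (ordE b) => -> [] ea [] eb; rewrite ea eb ?eqxx in ab *;
    rewrite ?a0 ?addr0 ?add0r ?lexx ?orbT //.
Qed.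

Lemma solved_zero s : feasible I (fun=> 0%R) ->
  nmem s 1 0 = 1 -> (forall i, rmem s 4 i = 0%R) -> solved I (l1_cost I) s.
Proof.
move=> f h1 h4; left; split=> //; exists (fun=> 0%R); split=> [|i _]; last exact: h4.
split=> // y [hy _ _]; rewrite /l1_cost; apply: ler_sum => e he; rewrite mulr0.
by apply: mulr_ge0; [apply: ucost_ge0 | case/andP: (hy e he)].
Qed.

Lemma solved_best s : 1 < n -> (0 < W)%R ->
  best_of n c (fun y => (False \/ candidate n W w l u a b y) \/
    candidate n W w l u b a y) s ->
  solved I (l1_cost I) s.
Proof.
move=> n1 W0; have la : leaf a by rewrite leaf_ord leaf_a.
have lb : leaf b by rewrite leaf_ord leaf_b.
move=> [[f0 none]|[f1 [y [h4 cand _ ymin]]]].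
  right; split=> // x /(feasible_candidate n1 _ W0) h; apply: (none (vector_of x)); tauto.
left; split=> //; exists (edge_function y).
have ey i : leaf i -> vector_of (edge_function y) i = y i.
  by move=> /leafE[v v0 ->]; rewrite vector_of_ord edge_functionE.
split; last first.
  move=> i; rewrite star_edges => i0; rewrite edge_functionE // h4 //.
  by rewrite leaf_ord.
split.
  apply/feasible_candidate => //.
  by case: cand => [[//|h]|h]; [left | right]; apply: candidate_ext h.
move=> x /(feasible_candidate n1 _ W0) h.
rewrite !total_cost_l1 (total_cost_ext _ ey); apply: ymin; tauto.
Qed.

Lemma solver_runs : runs solver (input I) (4800 * (10 * n.+1)) (solved I (l1_cost I)).
Proof.
set s0 := input I.
apply: (runs_if (t' := 4790 * (10 * n.+1))); last by rewrite /=; lia.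
  move=> /= n1; apply: runs_loopfree => //; first by rewrite [ccost _]/=; lia.
  by apply: solved_zero => //=; apply: feasible_edge.
rewrite /= -ltnNge ltnS => n1.
apply: (runs_seq_loopfree (t2 := 4780 * (10 * n.+1))) => //; last first.
  by rewrite [ccost _]/=; lia.
pose Inv s := nmem s 8 0 <= n.+1 /\
  rmem s 13 0 = (\sum_(i <- iota 0 (nmem s 8 0)) w i)%R.
apply: (runs_seq (t1 := 30 * n.+1 + 10) (t2 := 4770 * (10 * n.+1))
  (Q1 := fun s => rmem s 13 0 = W)); last by lia.
  apply: (@runs_for _ (fun s => nmem s 8 0) n.+1 30 Inv) => //.
  - by split=> //=; rewrite big_nil.
  - move=> s1 sm [hi hW] hb.
    have e00 : nmem s1 0 0 = n.+1 := sm.1 0 isT 0.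
    have e0 i : rmem s1 0 i = w i := sm.2 0 isT i.
    rewrite /= e00 in hb; split; last by rewrite /= /upd /=; lia.
    split; first by rewrite /= /upd /=; lia.
    rewrite /= /upd [nmem _ 8 0]/= hW e0 addn1 iota_rcons add0n.
    by rewrite -cats1 big_cat big_seq1.
  - move=> s1 sm [hi hW] hb.
    have e00 : nmem s1 0 0 = n.+1 := sm.1 0 isT 0.
    have e8 : nmem s1 8 0 = n.+1 by move: hb; rewrite /= e00; lia.
    by rewrite hW e8 total_weight.
  - by rewrite /= /upd /=; lia.
move=> s1 sm1 hW.
have n1_4 i : rmem s1 4 i = 0%R.
  by rewrite (sm1.2 4 isT).
apply: (runs_if (t' := 4760 * (10 * n.+1))); last by rewrite /=; lia.
  rewrite /= hW => W0; apply: runs_loopfree => //; first by rewrite [ccost _]/=; lia.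
  by apply: solved_zero => //; apply: feasible_weightless.
rewrite /= hW -ltNge => W0.
have la : leaf a by rewrite leaf_ord leaf_a.
have lb : leaf b by rewrite leaf_ord leaf_b.
have ab : a != b :> nat by exact: leaf_neq.
have ba : b != a :> nat by rewrite eq_sym.
have ge0 := input_ge0.
have l0 i : leaf i -> (0 <= l i)%R by case/ge0.
have u0 i : leaf i -> (0 <= u i)%R by case/ge0.
have c0 i : leaf i -> (0 <= c i)%R by case/ge0.
apply: (runs_seq_loopfree (t2 := 4750 * (10 * n.+1))) => //; last first.
  by rewrite [ccost _]/=; lia.
set s2 := srun _ s1.
have inp2 : inputs n W w l u c a b s2.
  split; first by split; exact: (sm1.1 0 isT).
  by split=> [i|i|i|i|]; [exact: (sm1.2 0 isT i) | exact: (sm1.2 1 isT i)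
    | exact: (sm1.2 2 isT i) | exact: (sm1.2 3 isT i) | exact: hW].
have best2 : best_of n c (fun=> False) s2.
  by left; split=> [|y []]; exact: (sm1.1 1 isT).
apply: (runs_seq (try_order_runs la lb ab c0 l0 u0 inp2 best2 (leqnn _)) _
  (t2 := 4710 * (5 * n.+1))); last by lia.
move=> s3 sm3 [inp3 best3].
apply: (runs_seq_loopfree (t2 := 4700 * (5 * n.+1))) => //; last first.
  by rewrite [ccost _]/=; lia.
set s4 := srun _ s3.
have inp4 : inputs n W w l u c b a s4.
  case: inp3 => [[h1 h2 h3] h4]; split=> //; split=> //; rewrite /s4 /= /upd /=.
    by rewrite (sm3.1 0 isT) /s2 /= /upd /= (sm1.1 0 isT).
  by rewrite (sm3.1 0 isT) /s2 /= /upd /= (sm1.1 0 isT).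
have best4 : best_of n c (fun y => False \/ candidate n W w l u a b y) s4 by [].
apply: runs_weaken (try_order_runs lb la ba c0 l0 u0 inp4 best4 (leqnn _)) _ _ => //.
by move=> s5 _ [_ best5]; apply: solved_best.
Qed.

End Bridge.

Theorem theorem2 :
  exists (p : cmd) (C : nat),
    forall (R : realFieldType) (n : nat) (I : instance R (star n)),
    exists (s : state R) (t : nat),
      exec p (input I) s t /\ (t <= C * n.+1)%N /\ solved I (l1_cost I) s.
Proof.
exists solver, (4800 * 10) => R n I.
have [s [t [e le h]]] := solver_runs I.
by exists s, t; split=> //; split=> //; rewrite -mulnA.
Qed.
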